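(* For a positive integer $n$, let $X_n$ denote the total height of a rooted labeled tree chosen uniformly at random among all $n^{n-1}$ rooted labeled trees on the vertex set $\{1,\dots,n\}$, and let $$W_n := \frac{n!}{n^{n-1}}\sum_{k=0}^{n-2}\frac{n^k}{k!}.$$ Then the fourth moment about the mean satisfies $$\mathbb{E}\big[(X_n-\mathbb{E}X_n)^4\big] = -3W_n^4 - 17 n W_n^3 + \left(\frac{5}{2}n^3 - \frac{217}{6}n^2 + \frac{1}{15}n\right)W_n^2 + \left(\frac{649}{80}n^4 - \frac{74381}{2160}n^3 + \frac{433}{2520}n^2 + \frac{1}{105}n\right)W_n$$ $$\qquad + \frac{221}{63}n^6 + \frac{4693}{540}n^5 - \frac{4651}{378}n^4 + \frac{109}{1260}n^3 + \frac{2}{105}n^2,$$ and, as $n\to\infty$, $$\mathbb{E}\big[(X_n-\mathbb{E}X_n)^4\big] \sim \left(-\frac{3}{4}\pi^2 + \frac{5}{4}\pi + \frac{221}{63}\right) n^6 .$$ Consequently the kurtosis $\mathbb{E}[(X_n-\mathbb{E}X_n)^4]/\operatorname{Var}(X_n)^{2}$ tends, as $n\to\infty$, to $$\frac{1}{7}\,\frac{-189\pi^2 + 315\pi + 884}{(10-3\pi)^2} = 3.560394751\dots$$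
   Context: A rooted labeled tree on $n$ vertices is a tree on the vertex set $\{1,\dots,n\}$ together with a distinguished vertex, the root. The height of a vertex is its graph distance to the root. The total height of a rooted labeled tree is the sum of the heights of all its vertices. All expectations and variances are taken with respect to the uniform distribution on the set of $n^{n-1}$ rooted labeled trees on $\{1,\dots,n\}$. The notation $a_n\sim b_n$ means $a_n/b_n\to 1$.
   Formalization: The printed decimal 3.560394751... is wrong: the closed form equals 3.560394897.... The formal theorem states the kurtosis limit as the exact closed form and asserts only that it lies in [3.560394, 3.560395). *)

(* Defs.v *)
From HB Require Import structures.
From mathcomp Require Import all_boot all_order all_algebra.
From mathcomp Require Import all_classical all_reals all_analysis.
Import Order.TTheory GRing.Theory Num.Theory numFieldNormedType.Exports.

Set Implicit Arguments.
Unset Strict Implicit.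
Unset Printing Implicit Defensive.

Local Open Scope ring_scope.

(* A simple graph on the vertex set 'I_n (standing for {1, ..., n}) is given by
   its set of edges, each edge being a two-element set of vertices. *)
Definition edge_rel (n : nat) (G : {set {set 'I_n}}) : rel 'I_n :=
  fun x y => (x != y) && ([set x; y]%SET \in G).

Definition simple_graph (n : nat) (G : {set {set 'I_n}}) : Prop :=
  forall e : {set 'I_n}, e \in G -> #|e| = 2%N.

Definition connected_graph (n : nat) (G : {set {set 'I_n}}) : Prop :=
  forall x y : 'I_n, connect (edge_rel G) x y.

(* An edge traversed back and forth is a [ucycle] of size 2, hence the bound. *)
Definition acyclic_graph (n : nat) (G : {set {set 'I_n}}) : Prop :=
  forall c : seq 'I_n, ucycle (edge_rel G) c -> (size c <= 2)%N.

Definition is_tree (n : nat) (G : {set {set 'I_n}}) : Prop :=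
  [/\ simple_graph G, connected_graph G & acyclic_graph G].

(* Pairs (tree, root). *)
Definition rooted_trees (n : nat) : {set {set {set 'I_n}} * 'I_n} :=
  [set t | `[< is_tree t.1 >]]%SET.

(* Least length (number of edges) of a walk from x to y.  A shortest walk has
   fewer than n edges; the value is n when y is not reachable from x. *)
Definition graph_dist (n : nat) (G : {set {set 'I_n}}) (x y : 'I_n) : nat :=
  \big[minn/n]_(k < n | [exists p : k.-tuple 'I_n,
                          path (edge_rel G) x p && (last x p == y)]) k.

Definition total_height (n : nat) (t : {set {set 'I_n}} * 'I_n) : nat :=
  (\sum_(v : 'I_n) graph_dist t.1 v t.2)%N.

Section Uniform.
Variables (R : realType) (T : finType) (A : {set T}).

(* Expectation, central moments and variance of X under the uniform
   distribution on A. *)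
Definition unif_expectation (X : T -> R) : R :=
  (\sum_(t in A) X t) / #|A|%:R.

Definition unif_central_moment (k : nat) (X : T -> R) : R :=
  unif_expectation (fun t => (X t - unif_expectation X) ^+ k).

Definition unif_variance (X : T -> R) : R := unif_central_moment 2 X.

End Uniform.

Definition height_rv (R : realType) (n : nat)
  (t : {set {set 'I_n}} * 'I_n) : R := (total_height t)%:R.

Definition height_mu4 (R : realType) (n : nat) : R :=
  unif_central_moment (rooted_trees n) 4 (@height_rv R n).

Definition height_var (R : realType) (n : nat) : R :=
  unif_variance (rooted_trees n) (@height_rv R n).

(* The sum runs over 0 <= k <= n - 2; it is empty for n = 1. *)
Definition W (R : realType) (n : nat) : R :=
  n`!%:R / n%:R ^+ n.-1 * \sum_(k < n.-1) n%:R ^+ k / k`!%:R.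

(* a_n ~ b_n *)
Definition seq_equiv (R : realType) (a b : nat -> R) : Prop :=
  ((fun n => a n / b n) @ \oo --> (1 : R))%classic.

(* Main.v *)
Require Import Defs.
From HB Require Import structures.
From mathcomp Require Import all_boot all_order all_algebra.
From mathcomp Require Import all_classical all_reals all_analysis.
From mathcomp Require Import ring lra zify.
Import Order.TTheory GRing.Theory Num.Theory numFieldNormedType.Exports.
(* [classical_sets] reuses many names of [finset]; the combinatorial part needs the latter. *)
Import mathcomp.boot.finset.

Set Implicit Arguments.
Unset Strict Implicit.
Unset Printing Implicit Defensive.

(* A rooted tree is encoded by its height function together with the choice,
   for every vertex of positive height, of a parent one level below, so that
   the moments of the total height satisfy a recursion that peels off the first
   level. In terms of exponential generating functions the recursion says that
   the moments of forests are e^(aT) B_k(a, 1/(1-T)), where T = z e^T and the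
   B_k are explicit polynomials. Lagrange inversion
     [z^m] g(T) = [u^m] g(u) (1-u) e^(mu)
   turns this into elementary identities between the numbers
     [u^m] e^(bu) (1-u)^(1-i),
   and for b = n, m = n-1 these numbers obey a three-term recurrence in i all of
   whose terms are linear in W_n.
   For the asymptotics, W_n/n is a sum of products prod_(i<j) (1 - i/n). These
   are compared with binomial ratios C(4n, 2n+j)/C(4n, 2n), whose sum is known
   exactly, and Wallis' inequalities give W_n^2/n^3 -> pi/2. *)

(** * Rooted trees as parent functions *)

(** Peeling off a level turns its j vertices into the roots of what remains, so the recursion does
    not close up at one root: the number a of roots has to stay a variable. Let F(z,s) generate the
    forests below one root, each weighted by e^(s h) with h its total height. Then F^a belongs to a
    roots, F = e^T at s = 0, and by Faa di Bruno the k-th s-derivative of F^a at s = 0 is F^a times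
    the sum over r of a^_r B_(k,r)(F'/F, F''/F, ...), where F^(k)/F = ['X * tree_poly k]. Peeling
    sums (aT)^j/j! over j, which replaces a^_r by (aT)^r. Since T 'X = 'X - 1, the factor 'X^r
    absorbs T^r and everything stays polynomial. Raising all m vertices by one level brings in
    powers of m, that is of z d/dz. For each k <= 4 the recursion is thus one polynomial identity in
    a and 'X, and checking it certifies the explicit coefficients of [tree_poly]. In the asymptotic
    part the row 4n is chosen because both C(4n, 2n+j)/C(4n, 2n) and prod_(i<j) (1 - i/n) behave
    like exp(-j^2/(2n)). *)

Section Trees.
Variable n : nat.
Implicit Types (G : {set {set 'I_n}}) (x y u v r : 'I_n).

Lemma edge_rel_sym G : symmetric (edge_rel G).
Proof. by move=> x y; rewrite /edge_rel eq_sym setUC. Qed.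

Lemma bigminn_le (I : eqType) (s : seq I) (P : pred I) (F : I -> nat) m j :
  j \in s -> P j -> \big[minn/m]_(i <- s | P i) F i <= F j.
Proof.
elim: s => // i s IH; rewrite inE big_cons => /orP[/eqP <- -> |/IH h Pj].
  exact: geq_minl.
by case: ifP => _; [apply: leq_trans (h Pj); exact: geq_minr | exact: h].
Qed.

Lemma bigminn_le_idx (I : Type) (s : seq I) (P : pred I) (F : I -> nat) m :
  \big[minn/m]_(i <- s | P i) F i <= m.
Proof.
elim: s => [|i s IH]; rewrite ?big_nil // big_cons; case: ifP => // _.
by apply: leq_trans IH; exact: geq_minr.
Qed.

Lemma bigminn_attained (I : eqType) (s : seq I) (P : pred I) (F : I -> nat) m :
  \big[minn/m]_(i <- s | P i) F i < m ->
  exists2 j, P j & \big[minn/m]_(i <- s | P i) F i = F j.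
Proof.
elim: s => [|i s IH]; first by rewrite big_nil ltnn.
rewrite big_cons; case: ifP => // Pi.
case: (leqP (F i) (\big[minn/m]_(i <- s | P i) F i)) => h /=.
  by move=> _; exists i.
exact: IH.
Qed.

Lemma graph_dist_le_walk G x y (p : seq 'I_n) :
  path (edge_rel G) x p -> last x p = y -> graph_dist G x y <= size p.
Proof.
move=> ep lp; case: (ltnP (size p) n) => [lt_n|]; last first.
  (* A walk with n or more edges is covered by the default value n of the minimum. *)
  by apply: leq_trans; exact: bigminn_le_idx.
rewrite /graph_dist (@bigminn_le _ _ _ (fun k : 'I_n => k : nat) n (Ordinal lt_n)) //.
  by rewrite mem_index_enum.
by apply/existsP; exists (in_tuple p); rewrite /= ep lp eqxx.
Qed.

(** A walk without repeated vertices has fewer than n edges, so the minimum lies strictly below its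
    default value and is attained. *)
Lemma graph_dist_walk G x y : connected_graph G ->
  exists p : seq 'I_n,
    [/\ path (edge_rel G) x p, last x p = y & size p = graph_dist G x y].
Proof.
move=> /(_ x y)/connectP[p ep lp].
have [q [eq lq uq]] : exists q, [/\ path (edge_rel G) x q, last x q = y & uniq (x :: q)].
  by move: lp; case/shortenP: ep => q eq uq _ ->; exists q.
have ltn : graph_dist G x y < n.
  apply: leq_ltn_trans (graph_dist_le_walk eq lq) _.
  by have := max_card (mem (x :: q)); rewrite (card_uniqP uq) card_ord.
have [k /existsP[t /andP[et /eqP lt]] e] := bigminn_attained ltn.
by exists t; rewrite size_tuple /graph_dist e.
Qed.

Section RootedTree.
Variables (r : 'I_n) (l : 'I_n -> nat) (p : 'I_n -> 'I_n).
Hypothesis l_root : l r = 0.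
Hypothesis l_parent : forall v, v != r -> (l (p v)).+1 = l v.

Definition parent_graph : {set {set 'I_n}} := [set [set v; p v] | v in [set~ r]].

Lemma parent_neq v : v != r -> v != p v.
Proof. by move=> vr; apply/eqP => e; have := l_parent vr; rewrite -e; lia. Qed.

Lemma set2_inj (T : finType) (a b c d : T) : [set a; b] = [set c; d] ->
  (a = c /\ b = d) \/ (a = d /\ b = c).
Proof.
move=> e.
have := set21 a b; have := set22 a b; have := set21 c d; have := set22 c d.
rewrite {1 2}e -{1 2}e !inE.
by do 4![case/orP=> /eqP ?]; subst; tauto.
Qed.

Lemma edge_parent_graphP x y :
  reflect ((x != r /\ y = p x) \/ (y != r /\ x = p y)) (edge_rel parent_graph x y).
Proof.
apply: (iffP idP) => [/andP[xy /imsetP[v]] | ].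
  rewrite !inE => vr /set2_inj[[-> ->]|[-> ->]]; [by left | by right].
move=> [[xr ->]|[yr ->]]; rewrite /edge_rel.
  by rewrite parent_neq //; apply/imsetP; exists x; rewrite ?inE.
by rewrite eq_sym parent_neq // setUC; apply/imsetP; exists y; rewrite ?inE.
Qed.

Lemma parent_graph_simple : simple_graph parent_graph.
Proof. by move=> e /imsetP[v]; rewrite !inE => vr ->; rewrite cards2 parent_neq. Qed.

Lemma parent_graph_walk v : exists q : seq 'I_n,
  [/\ path (edge_rel parent_graph) v q, last v q = r & size q = l v].
Proof.
move e : (l v) => k; elim: k v e => [|k IH] v e.
  exists [::]; split=> //=; apply/eqP; apply: contraTT isT => /l_parent.
  by rewrite e.
have vr : v != r by apply: contra_eqN e => /eqP ->; rewrite l_root.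
have [q [eq lq sq]] := IH (p v) (succn_inj (etrans (l_parent vr) e)).
exists (p v :: q); split=> //=; last by rewrite sq.
by rewrite eq andbT; apply/edge_parent_graphP; left.
Qed.

Lemma parent_graph_connected : connected_graph parent_graph.
Proof.
have c v : connect (edge_rel parent_graph) v r.
  by have [q [eq lq _]] := parent_graph_walk v; apply/connectP; exists q.
move=> x y; apply: connect_trans (c x) _.
by rewrite (sym_connect_sym (edge_rel_sym _)).
Qed.

(** The height changes by exactly one along an edge, so a walk lowers it by at most its length. *)
Lemma parent_graph_walk_size v q : path (edge_rel parent_graph) v q ->
  l v <= l (last v q) + size q.
Proof.
elim: q v => [|u q IH] v /=; first by rewrite addn0.
move=> /andP[/edge_parent_graphP e /IH]; rewrite addnS => h.
apply: (@leq_trans (l u).+1); last by rewrite ltnS.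
by case: e => -[/l_parent <- ->] //; apply: leqW; apply: leqW.
Qed.

Lemma parent_graph_dist v : graph_dist parent_graph v r = l v.
Proof.
apply/eqP; rewrite eqn_leq; apply/andP; split.
  have [q [eq lq <-]] := parent_graph_walk v; exact: graph_dist_le_walk eq lq.
have [q [eq lq <-]] := graph_dist_walk v r parent_graph_connected.
by have := parent_graph_walk_size eq; rewrite lq l_root.
Qed.

(* At a vertex of a cycle that is farthest from the root, both cyclic
   neighbours are its parent. *)
Lemma parent_graph_acyclic : acyclic_graph parent_graph.
Proof.
move=> c; case: c => [//|x c'] /andP[]; set c := x :: c' => cyc uc.
have xc : x \in c by rewrite mem_head.
case: (@arg_maxnP _ x (mem c) l xc) => v vc vmax.
have [i s rot_c] := rot_to vc.
have us : uniq (v :: s) by rewrite -rot_c rot_uniq.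
have cs : cycle (edge_rel parent_graph) (v :: s) by rewrite -rot_c rot_cycle.
have up u : u \in v :: s -> edge_rel parent_graph v u -> u = p v.
  move=> us' /edge_parent_graphP[[//]|[ur vE]].
  have /vmax : u \in c by rewrite -(mem_rot i) rot_c.
  by rewrite /= -(l_parent ur) -vE ltnn.
rewrite -(size_rot i) rot_c /=.
case: s us cs up {rot_c} => [//|a s] us cs up.
move: cs => /=; rewrite rcons_path => /andP[va /andP[_ bv]].
have ea : a = p v by apply: up va; rewrite !inE eqxx orbT.
have eb : last a s = p v.
  apply: up; last by rewrite edge_rel_sym.
  by rewrite inE mem_last orbT.
case: s us eb {up bv} => [//|b s] /= /and3P[_ /negP ans _] eb.
by case: ans; rewrite ea -eb mem_last.
Qed.

Lemma parent_graph_tree : is_tree parent_graph.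
Proof.
split; [exact: parent_graph_simple | exact: parent_graph_connected |].
exact: parent_graph_acyclic.
Qed.

(** An edge of [G] outside [parent_graph] would close the path of [parent_graph] between its ends
    into a cycle with at least three vertices. *)
Lemma tree_eq_parent_graph G : is_tree G ->
  (forall v, v != r -> edge_rel G v (p v)) -> G = parent_graph.
Proof.
move=> [simG _ acG] Gp.
have sub x y : edge_rel parent_graph x y -> edge_rel G x y.
  move=> /edge_parent_graphP[[xr ->]|[yr ->]]; first exact: Gp.
  by rewrite edge_rel_sym; exact: Gp.
apply/setP => e; apply/idP/idP => [eG|/imsetP[v]]; last first.
  by rewrite !inE => /Gp /andP[_ ?] ->.
have /cards2P[x [y [xy eE]]] : #|e| == 2 by rewrite simG.
apply: contraT => eT.
have /connectP[q0 eq0 lq0] := parent_graph_connected x y.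
have [q [eq lq uq]] : exists q,
    [/\ path (edge_rel parent_graph) x q, last x q = y & uniq (x :: q)].
  by move: lq0; case/shortenP: eq0 => q eq uq _ ->; exists q.
have : ucycle (edge_rel G) (x :: q).
  rewrite /ucycle uq andbT /= rcons_path (sub_path sub eq) lq /=.
  by rewrite edge_rel_sym /edge_rel xy -eE eG.
move=> /acG; case: q eq lq {uq} => [|z [|//]] /=.
  by move=> _ xy'; rewrite xy' eqxx in xy.
by rewrite andbT => /andP[_ +] zy; rewrite zy -eE (negPf eT).
Qed.

End RootedTree.
End Trees.

(** * Coefficient extraction by Lagrange inversion *)

Section LagrangeFunctional.
Local Open Scope ring_scope.
Variable R : realFieldType.
Implicit Types (a b c : R) (g h : {poly R}).

(* [u^m] e^(bu) (1-u)^(1-i): the cases i = 0 and i = 1 are exponential sums, and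
   dividing by 1 - u amounts to taking partial sums. *)
Fixpoint expgeom_coef (i : nat) b (m : nat) : R :=
  if i is i'.+1 then \sum_(t < m.+1) expgeom_coef i' b t
  else b ^+ m / m`!%:R - (if m is m'.+1 then b ^+ m' / m'`!%:R else 0).

Arguments expgeom_coef : simpl never.

Lemma expgeom_coef_at0 i b : expgeom_coef i b 0 = 1.
Proof. by elim: i => [|i IH]; rewrite /expgeom_coef ?big_ord1 // expr0 divr1 subr0. Qed.

Lemma expgeom_coefS i b m :
  expgeom_coef i.+1 b m.+1 = expgeom_coef i.+1 b m + expgeom_coef i b m.+1.
Proof. by rewrite [LHS]/expgeom_coef big_ord_recr. Qed.

Lemma expgeom_coef0S b m :
  expgeom_coef 0 b m.+1 = b ^+ m.+1 / m.+1`!%:R - b ^+ m / m`!%:R.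
Proof. by []. Qed.

Lemma natr_fact_neq0 (m : nat) : (m`!%:R : R) != 0.
Proof. by rewrite pnatr_eq0 -lt0n fact_gt0. Qed.

Lemma natrS_neq0 (m : nat) : (m.+1%:R : R) != 0.
Proof. by rewrite pnatr_eq0. Qed.

Lemma expgeom_coef1 b m : expgeom_coef 1 b m = b ^+ m / m`!%:R.
Proof.
elim: m => [|m IH]; first by rewrite expgeom_coef_at0 expr0 divr1.
by rewrite expgeom_coefS IH expgeom_coef0S addrC subrK.
Qed.

(** Coefficient of u^m in the derivative b e^(bu) (1-u)^(1-i) + (i-1) e^(bu) (1-u)^(-i). *)
Lemma expgeom_coef_deriv i b m :
  m.+1%:R * expgeom_coef i b m.+1
  = b * expgeom_coef i b m + (i%:R - 1) * expgeom_coef i.+1 b m.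
Proof.
elim: i m => [|i IH] m.
  rewrite expgeom_coef1 expgeom_coef0S factS natrM exprS.
  case: m => [|m]; first by rewrite expgeom_coef_at0 expr0 fact0; field.
  rewrite expgeom_coef0S factS natrM !exprS; have := natr_fact_neq0 m.
  have := natrS_neq0 m; have := natrS_neq0 m.+1; rewrite -[m.+2%:R]natr1.
  by move: m.+1%:R m`!%:R (b ^+ m) => x y z x1 x0 y0; field; rewrite x0 x1 y0.
elim: m => [|m IHm].
  rewrite expgeom_coefS !expgeom_coef_at0.
  by have := IH 0%N; rewrite !expgeom_coef_at0 -!natr1; lra.
rewrite expgeom_coefS mulrDr IH.
rewrite -[m.+2%:R]natr1 mulrDl mul1r IHm.
rewrite ![expgeom_coef i.+1 _ m.+1]expgeom_coefS.
rewrite ![expgeom_coef i.+2 _ m.+1]expgeom_coefS.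
rewrite ![expgeom_coef i.+1 _ m.+1]expgeom_coefS -!natr1.
ring.
Qed.

(** This is the Euler operator on 'X^i. In the derivative formula for i + 1 the part m + 1 of b
    cancels against the partial sum relation [expgeom_coefS]; hence the coupling of b to the index
    of the coefficient. *)
Lemma expgeom_coef_mulm i a m :
  m.+1%:R * expgeom_coef i (m.+1%:R + a) m.+1
  = a * expgeom_coef i.+1 (m.+1%:R + a) m
    + i%:R * expgeom_coef i.+2 (m.+1%:R + a) m.
Proof.
have := expgeom_coef_deriv i.+1 (m.+1%:R + a) m.
rewrite expgeom_coefS -[i.+1%:R]natr1 addrK mulrDr mulrDl => e.
by apply: (addrI (m.+1%:R * expgeom_coef i.+1 (m.+1%:R + a) m)); rewrite e addrA.
Qed.

Lemma sum_expgeom_coefS i a b m :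
  \sum_(j < m.+2) a ^+ j / j`!%:R * expgeom_coef i.+1 b (m.+1 - j)
  = \sum_(j < m.+1) a ^+ j / j`!%:R * expgeom_coef i.+1 b (m - j)
    + \sum_(j < m.+2) a ^+ j / j`!%:R * expgeom_coef i b (m.+1 - j).
Proof.
rewrite big_ord_recr [X in _ = _ + X]big_ord_recr /= addrA -big_split /=.
rewrite subnn !expgeom_coef_at0; congr (_ + _); apply: eq_bigr => j _.
by rewrite -mulrDr subSn -1?ltnS // expgeom_coefS.
Qed.

(** Multiplication by e^(au). The case i = 1 is the binomial theorem; differences then give i = 0,
    and partial sums give all larger i. *)
Lemma expgeom_coef_shift i a b m :
  \sum_(j < m.+1) a ^+ j / j`!%:R * expgeom_coef i b (m - j)
  = expgeom_coef i (b + a) m.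
Proof.
have at1 n : \sum_(j < n.+1) a ^+ j / j`!%:R * expgeom_coef 1 b (n - j)
    = expgeom_coef 1 (b + a) n.
  rewrite expgeom_coef1 exprDn mulr_suml; apply: eq_bigr => j _.
  rewrite expgeom_coef1; have lejn : (j <= n)%N by rewrite -ltnS.
  have := natr_fact_neq0 j; have := natr_fact_neq0 (n - j); have := natr_fact_neq0 n.
  rewrite -[_ *+ 'C(n, j)]mulr_natr -(bin_fact lejn) !natrM !mulf_eq0 !negb_or.
  move=> /andP[binj _] u v.
  by field; rewrite u v binj.
elim: i m => [|i IH] [|m]; rewrite ?big_ord1 ?expr0 ?divr1 ?mul1r ?subnn ?expgeom_coef_at0 //.
  apply: (addrI (expgeom_coef 1 (b + a) m)); rewrite -expgeom_coefS -!at1.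
  by rewrite sum_expgeom_coefS.
elim: m => [|m IHm]; rewrite sum_expgeom_coefS IH expgeom_coefS ?IHm //.
by rewrite big_ord1 expr0 divr1 mul1r !expgeom_coef_at0.
Qed.

(* With 'X standing for 1/(1-u), this is [u^m] e^(bu) (1-u) g. For b = m + a it is
   the coefficient [z^m] e^(aT) g(1/(1-T)), where T = z e^T. *)
Definition lagrange_form b m g : R := \sum_(i < size g) g`_i * expgeom_coef i b m.

Lemma lagrange_form_widen b m g n : (size g <= n)%N ->
  lagrange_form b m g = \sum_(i < n) g`_i * expgeom_coef i b m.
Proof.
move=> le_n; rewrite /lagrange_form (big_ord_widen _ (fun i => g`_i * expgeom_coef i b m) le_n).
rewrite big_mkcond; apply: eq_bigr => i _; case: ltnP => // /(nth_default 0) ->.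
by rewrite mul0r.
Qed.

Lemma lagrange_formD b m g h :
  lagrange_form b m (g + h) = lagrange_form b m g + lagrange_form b m h.
Proof.
rewrite !(@lagrange_form_widen b m _ (maxn (size g) (size h))) ?leq_maxl ?leq_maxr ?size_polyD //.
by rewrite -big_split; apply: eq_bigr => i _; rewrite coefD mulrDl.
Qed.

Lemma lagrange_formZ b m c g : lagrange_form b m (c *: g) = c * lagrange_form b m g.
Proof.
rewrite (@lagrange_form_widen b m (c *: g) (size g)) ?size_scale_leq // mulr_sumr.
by apply: eq_bigr => i _; rewrite coefZ mulrA.
Qed.

Lemma lagrange_form0 b m : lagrange_form b m 0 = 0.
Proof. by rewrite -(scale0r 0) lagrange_formZ mul0r. Qed.

Lemma lagrange_formMn b m g n :
  lagrange_form b m (g *+ n) = n%:R * lagrange_form b m g.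
Proof.
elim: n => [|n IH]; first by rewrite mulr0n lagrange_form0 mul0r.
by rewrite mulrS lagrange_formD IH -nat1r mulrDl mul1r.
Qed.

Lemma lagrange_formB b m g h :
  lagrange_form b m (g - h) = lagrange_form b m g - lagrange_form b m h.
Proof. by rewrite -scaleN1r lagrange_formD lagrange_formZ mulN1r. Qed.

Lemma lagrange_form_sum b m (I : Type) (r : seq I) (P : pred I) (F : I -> {poly R}) :
  lagrange_form b m (\sum_(i <- r | P i) F i)
  = \sum_(i <- r | P i) lagrange_form b m (F i).
Proof.
exact: (big_morph _ (lagrange_formD b m) (lagrange_form0 b m)).
Qed.

Lemma lagrange_formXn b m n : lagrange_form b m 'X^n = expgeom_coef n b m.
Proof.
rewrite /lagrange_form size_polyXn (bigD1 ord_max) //= coefXn eqxx mul1r big1 ?addr0 //.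
by move=> i ne_in; rewrite coefXn -val_eqE in ne_in *; rewrite (negPf ne_in) mul0r.
Qed.

Lemma poly_lin_ind (P : {poly R} -> Prop) :
  (forall g h, P g -> P h -> P (g + h)) -> (forall c g, P g -> P (c *: g)) ->
  (forall n, P 'X^n) -> forall g, P g.
Proof.
move=> PD PZ PX g; rewrite -[g]coefK poly_def; apply: big_ind => [|//|i _].
  by rewrite -(scale0r 'X^0); apply/PZ.
exact/PZ.
Qed.

(** 'X - 1 stands for u/(1-u), that is u 'X, and multiplying by u shifts the coefficient by one; the
    next lemma is the vanishing constant term. *)
Lemma lagrange_formMX b m g :
  lagrange_form b m ('X * g) = lagrange_form b m.+1 (('X - 1) * g).
Proof.
rewrite mulrBl mul1r; elim/poly_lin_ind: g => [g h eg eh|c g eg|n].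
- by rewrite !mulrDr opprD addrACA lagrange_formD eg eh [RHS]lagrange_formD.
- by rewrite -!scalerAr -scalerBr !lagrange_formZ eg.
- by rewrite -exprS lagrange_formB !lagrange_formXn expgeom_coefS addrK.
Qed.

Lemma lagrange_formMX1_at0 b g : lagrange_form b 0 (('X - 1) * g) = 0.
Proof.
rewrite mulrBl mul1r; elim/poly_lin_ind: g => [g h eg eh|c g eg|n].
- by rewrite !mulrDr opprD addrACA lagrange_formD eg eh addr0.
- by rewrite -!scalerAr -scalerBr !lagrange_formZ eg mulr0.
- by rewrite -exprS lagrange_formB !lagrange_formXn !expgeom_coef_at0 subrr.
Qed.

(* The operator z d/dz acting on e^(aT) g(1/(1-T)). *)
Definition euler_op a g : {poly R} := a *: (('X - 1) * g) + 'X^2 * ('X - 1) * g^`().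

Lemma lagrange_form_euler a m g :
  m%:R * lagrange_form (m%:R + a) m g = lagrange_form (m%:R + a) m (euler_op a g).
Proof.
case: m => [|m].
  rewrite mul0r /euler_op lagrange_formD lagrange_formZ ['X^2 * _]mulrC -mulrA.
  by rewrite !lagrange_formMX1_at0 mulr0 addr0.
elim/poly_lin_ind: g => [g h eg eh|c g eg|n].
- rewrite lagrange_formD mulrDr eg eh -lagrange_formD /euler_op derivD !mulrDr scalerDr.
  by rewrite addrACA.
- rewrite lagrange_formZ mulrCA eg -lagrange_formZ /euler_op derivZ.
  by rewrite -!scalerAr scalerDr !scalerA mulrC.
- rewrite /euler_op lagrange_formXn expgeom_coef_mulm lagrange_formD lagrange_formZ.
  rewrite -lagrange_formMX -exprS lagrange_formXn derivXn.
  rewrite mulrnAr lagrange_formMn [_ * ('X - 1)]mulrC -mulrA; congr (_ + _).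
  case: n => [|n]; first by rewrite !mul0r.
  by rewrite exprS -!mulrA -lagrange_formMX -!exprS lagrange_formXn.
Qed.

Lemma lagrange_form_shift a b m g :
  \sum_(j < m.+1) a ^+ j / j`!%:R * lagrange_form b (m - j) g
  = lagrange_form (b + a) m g.
Proof.
elim/poly_lin_ind: g => [g h eg eh|c g eg|n].
- rewrite lagrange_formD -eg -eh -big_split; apply: eq_bigr => j _.
  by rewrite lagrange_formD mulrDr.
- rewrite lagrange_formZ -eg mulr_sumr; apply: eq_bigr => j _.
  by rewrite lagrange_formZ mulrCA.
- rewrite lagrange_formXn -expgeom_coef_shift.
  by apply: eq_bigr => j _; rewrite lagrange_formXn.
Qed.

(* This is sum_j j^_r x^j / j! = x^r e^x, at x = a u with u = (X - 1)/X. *)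
Lemma lagrange_form_ffact r a b m g :
  \sum_(j < m.+1) (j ^_ r)%:R * (a ^+ j / j`!%:R) * lagrange_form b (m - j) ('X^r * g)
  = a ^+ r * lagrange_form (b + a) m (('X - 1) ^+ r * g).
Proof.
elim: r m g => [|r IH] m g.
  by rewrite !mul1r -lagrange_form_shift; apply: eq_bigr => j _; rewrite !mul1r.
rewrite big_ord_recl ffact0n !mul0r add0r.
case: m => [|m].
  by rewrite big_ord0 [('X - 1) ^+ _]exprS -mulrA lagrange_formMX1_at0 mulr0.
transitivity (a * \sum_(j < m.+1) (j ^_ r)%:R * (a ^+ j / j`!%:R)
    * lagrange_form b (m - j) ('X^r * ('X * g))).
  rewrite mulr_sumr; apply: eq_bigr => j _.
  rewrite /bump /= ffactSS subSS ['X^(r.+1)]exprSr -['X^r * 'X * g]mulrA exprS factS !natrM.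
  rewrite [RHS]mulrA; congr (_ * _).
  have := natr_fact_neq0 j; have := natrS_neq0 j.
  move: (j ^_ r)%:R j.+1%:R j`!%:R (a ^+ j) => x y z t y0 z0.
  by field; rewrite y0 z0.
have -> : \sum_(j < m.+1) (j ^_ r)%:R * (a ^+ j / j`!%:R)
      * lagrange_form b (m - j) ('X^r * ('X * g))
    = \sum_(j < m.+2) (j ^_ r)%:R * (a ^+ j / j`!%:R)
      * lagrange_form b (m.+1 - j) ('X^r * (('X - 1) * g)).
  rewrite [RHS]big_ord_recr /= subnn [_ * (('X - 1) * g)]mulrCA lagrange_formMX1_at0.
  rewrite mulr0 addr0; apply: eq_bigr => j _; rewrite subSn -1?ltnS //.
  by rewrite ['X^r * ('X * g)]mulrCA lagrange_formMX.
by rewrite IH mulrA -exprS mulrA -exprSr.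
Qed.

(* The sum of phi (total height) over the rooted forests in which m labelled
   vertices hang below a labelled roots; j is the number of vertices of
   height 1. The argument K bounds the number of levels. *)
Fixpoint level_moment (K a m : nat) (phi : nat -> R) : R :=
  if K is K'.+1 then
    \sum_(j < m.+1) ('C(m, j) * a ^ j)%:R
      * level_moment K' j (m - j) (fun x => phi (m + x)%N)
  else (m == 0)%:R * phi 0.

Lemma eq_level_moment K (a m : nat) (phi psi : nat -> R) : phi =1 psi ->
  level_moment K a m phi = level_moment K a m psi.
Proof.
elim: K a m phi psi => [|K IH] a m phi psi e /=; first by rewrite e.
by apply: eq_bigr => j _; congr (_ * _); apply: IH => x; rewrite e.
Qed.

Lemma level_moment_sum K (a m n : nat) (c : nat -> R) (phi : nat -> nat -> R) :
  level_moment K a m (fun x => \sum_(i < n) c i * phi i x)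
  = \sum_(i < n) c i * level_moment K a m (phi i).
Proof.
elim: K a m phi => [|K IH] a m phi /=.
  by rewrite mulr_sumr; apply: eq_bigr => i _; rewrite mulrCA.
under eq_bigr => j _ do rewrite (IH _ _ (fun i x => phi i (m + x)%N)) mulr_sumr.
rewrite exchange_big; apply: eq_bigr => i _; rewrite mulr_sumr.
by apply: eq_bigr => j _; rewrite mulrCA.
Qed.

Lemma level_moment0r K (a : nat) (phi : nat -> R) : level_moment K a 0 phi = phi 0.
Proof.
elim: K a phi => [|K IH] a phi /=; first by rewrite mul1r.
by rewrite big_ord1 IH mul1r addn0.
Qed.

Lemma level_moment0l K (m : nat) (phi : nat -> R) : level_moment K 0 m.+1 phi = 0.
Proof.
elim: K phi => [|K IH] phi /=; first by rewrite mul0r.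
rewrite big_ord_recl subn0 IH mulr0 add0r big1 // => j _.
by rewrite exp0n // muln0 mul0r.
Qed.

End LagrangeFunctional.
Arguments expgeom_coef : simpl never.

(** * Explicit moment polynomials of forests and their recursion *)

Section Bell.
Local Open Scope ring_scope.
Variable R : realFieldType.

(* With 'X = 1/(1-T), the polynomial ('X - 1) * tree_poly k is the exponential
   generating function of the sums of the k-th powers of the total height over
   rooted trees (k >= 1). Large coefficients are written in base 100 because
   numerals denote unary naturals. *)
Definition tree_poly (k : nat) : {poly R} :=
  match k with
  | 1%N => 'X - 1
  | 2%N => 'X^2 * ('X - 1) * (5 * 'X - 4)
  | 3%N => 'X^3 * ('X - 1) * (90 * 'X^3 - (10 ^+ 2 + 73) * 'X^2 + (10 ^+ 2) * 'X - 16)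
  | 4%N => 'X^4 * ('X - 1)
      * ((33 * 10 ^+ 2 + 15) * 'X^5 - (10 ^+ 4 + 10 ^+ 2 + 41) * 'X^4
         + (10 ^+ 4 + 15 * 10 ^+ 2 + 74) * 'X^3 - (60 * 10 ^+ 2 + 1) * 'X^2
         + (13 * 10 ^+ 2 + 50) * 'X - 96)
  | _ => 0
  end.

(* The partial Bell polynomials in tree_poly 1, tree_poly 2, ... *)
Definition tree_bell_poly (k r : nat) : {poly R} :=
  let N := tree_poly in
  match k, r with
  | 0%N, 0%N => 1
  | 1%N, 1%N | 2%N, 1%N | 3%N, 1%N | 4%N, 1%N => N k
  | 2%N, 2%N => N 1%N ^+ 2
  | 3%N, 2%N => 3 * N 1%N * N 2%N
  | 3%N, 3%N => N 1%N ^+ 3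
  | 4%N, 2%N => 4 * N 1%N * N 3%N + 3 * N 2%N ^+ 2
  | 4%N, 3%N => 6 * N 1%N ^+ 2 * N 2%N
  | 4%N, 4%N => N 1%N ^+ 4
  | _, _ => 0
  end.

(* e^(aT) times this polynomial at 1/(1-T) generates the sums of the k-th powers of
   the total height over the forests with a given roots. *)
Definition forest_poly k (a : nat) : {poly R} :=
  \sum_(r < 5) (a ^_ r)%:R *: ('X^r * tree_bell_poly k r).

(* Each falling factorial a^_r of forest_poly is replaced by (a T)^r, T = 1 - 1/'X. *)
Definition forest_poly_exp k (a : R) : {poly R} :=
  \sum_(r < 5) a ^+ r *: (('X - 1) ^+ r * tree_bell_poly k r).

Lemma natr_ffact (a r : nat) : (a ^_ r)%:R = \prod_(i < r) (a%:R - i%:R) :> R.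
Proof.
elim: r => [|r IH]; first by rewrite big_ord0.
rewrite ffactnSr big_ord_recr /= natrM IH.
case: (leqP r a) => [/natrB -> //|lt_ar]; rewrite -IH ffact_small // !mul0r.
by [].
Qed.

Lemma euler_opE a (g : {poly R}) :
  euler_op a g = a%:P * (('X - 1) * g) + 'X^2 * ('X - 1) * g^`().
Proof. by rewrite /euler_op mul_polyC. Qed.

Lemma forest_polyE k (a : nat) : let x := (a%:R)%:P in
  forest_poly k a = tree_bell_poly k 0 + x * ('X * tree_bell_poly k 1)
    + x * (x - 1) * ('X^2 * tree_bell_poly k 2)
    + x * (x - 1) * (x - 2) * ('X^3 * tree_bell_poly k 3)
    + x * (x - 1) * (x - 2) * (x - 3) * ('X^4 * tree_bell_poly k 4).
Proof.
rewrite /forest_poly !big_ord_recr big_ord0 /= !natr_ffact !big_ord_recr !big_ord0 /=.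
rewrite -!mul_polyC !(polyCM, polyCB, polyC1, polyC_natr).
ring.
Qed.

Lemma forest_poly_expE k (a : R) : let x := a%:P in
  forest_poly_exp k a = tree_bell_poly k 0 + x * (('X - 1) * tree_bell_poly k 1)
    + x ^+ 2 * (('X - 1) ^+ 2 * tree_bell_poly k 2)
    + x ^+ 3 * (('X - 1) ^+ 3 * tree_bell_poly k 3)
    + x ^+ 4 * (('X - 1) ^+ 4 * tree_bell_poly k 4).
Proof.
rewrite /forest_poly_exp !big_ord_recr big_ord0 /= -!mul_polyC !polyC_exp.
ring.
Qed.

Ltac euler_ring :=
  rewrite euler_opE !(derivD, derivZ, derivXn) /= -!mul_polyC; ring.

(** The level recursion for generating functions: the binomial expansion of (m + x)^k, with m^i
    acting as the i-th iterate of the Euler operator. *)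
Lemma forest_poly_rec k (a : nat) : (k < 5)%N ->
  forest_poly k a =
  \sum_(i < k.+1) 'C(k, i)%:R *: iter i (euler_op a%:R) (forest_poly_exp (k - i) a%:R).
Proof.
(* With the falling factorials expanded, a may be an arbitrary element of [R] and the goal is an
   identity of polynomials in a and 'X. The iterates are recorded in expanded form, so that each one
   takes a single application of [euler_op]. *)
move=> lt5; rewrite forest_polyE /=; move: a%:R => {}a.
have bE := (erefl : 'C(4, 2) = 6%N, erefl : 'C(4, 3) = 4%N, erefl : 'C(3, 2) = 3%N).
have e00 : forest_poly_exp 0 a =
     1 *: 'X^0.
  by rewrite forest_poly_expE /= -!mul_polyC; ring.
have e01 : euler_op a (forest_poly_exp 0 a) =
     a *: 'X^1 + (- a) *: 'X^0.
  by rewrite e00; euler_ring.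
have e02 : euler_op a (euler_op a (forest_poly_exp 0 a)) =
     a *: 'X^3 + (a ^+ 2 - a) *: 'X^2 + (- (2 * a ^+ 2)) *: 'X^1
      + (a ^+ 2) *: 'X^0.
  by rewrite e01; euler_ring.
have e03 : euler_op a (euler_op a (euler_op a (forest_poly_exp 0 a))) =
     (3 * a) *: 'X^5 + (3 * a ^+ 2 - 5 * a) *: 'X^4
      + (a ^+ 3 - 6 * a ^+ 2 + 2 * a) *: 'X^3
      + (- (3 * a ^+ 3) + 3 * a ^+ 2) *: 'X^2 + (3 * a ^+ 3) *: 'X^1
      + (- a ^+ 3) *: 'X^0.
  by rewrite e02; euler_ring.
have e04 : euler_op a (euler_op a (euler_op a (euler_op a (forest_poly_exp 0 a)))) =
     (15 * a) *: 'X^7 + (15 * a ^+ 2 - 35 * a) *: 'X^6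
      + (6 * a ^+ 3 - 38 * a ^+ 2 + 26 * a) *: 'X^5
      + (a ^+ 4 - 18 * a ^+ 3 + 31 * a ^+ 2 - 6 * a) *: 'X^4
      + (- (4 * a ^+ 4) + 18 * a ^+ 3 - 8 * a ^+ 2) *: 'X^3
      + (6 * a ^+ 4 - 6 * a ^+ 3) *: 'X^2 + (- (4 * a ^+ 4)) *: 'X^1
      + (a ^+ 4) *: 'X^0.
  by rewrite e03; euler_ring.
have e10 : forest_poly_exp 1 a =
     a *: 'X^2 + (- (2 * a)) *: 'X^1 + a *: 'X^0.
  by rewrite forest_poly_expE /= -!mul_polyC; ring.
have e11 : euler_op a (forest_poly_exp 1 a) =
     (2 * a) *: 'X^4 + (a ^+ 2 - 4 * a) *: 'X^3 + (- (3 * a ^+ 2) + 2 * a) *: 'X^2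
      + (3 * a ^+ 2) *: 'X^1 + (- a ^+ 2) *: 'X^0.
  by rewrite e10; euler_ring.
have e12 : euler_op a (euler_op a (forest_poly_exp 1 a)) =
     (8 * a) *: 'X^6 + (5 * a ^+ 2 - 20 * a) *: 'X^5
      + (a ^+ 3 - 15 * a ^+ 2 + 16 * a) *: 'X^4
      + (- (4 * a ^+ 3) + 15 * a ^+ 2 - 4 * a) *: 'X^3
      + (6 * a ^+ 3 - 5 * a ^+ 2) *: 'X^2 + (- (4 * a ^+ 3)) *: 'X^1
      + (a ^+ 3) *: 'X^0.
  by rewrite e11; euler_ring.
have e13 : euler_op a (euler_op a (euler_op a (forest_poly_exp 1 a))) =
     (48 * a) *: 'X^8 + (33 * a ^+ 2 - (10 ^+ 2 + 48) * a) *: 'X^7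
      + (9 * a ^+ 3 - (10 ^+ 2 + 13) * a ^+ 2 + (10 ^+ 2 + 64) * a) *: 'X^6
      + (a ^+ 4 - 36 * a ^+ 3 + (10 ^+ 2 + 41) * a ^+ 2 - 76 * a) *: 'X^5
      + (- (5 * a ^+ 4) + 54 * a ^+ 3 - 75 * a ^+ 2 + 12 * a) *: 'X^4
      + (10 * a ^+ 4 - 36 * a ^+ 3 + 14 * a ^+ 2) *: 'X^3
      + (- (10 * a ^+ 4) + 9 * a ^+ 3) *: 'X^2 + (5 * a ^+ 4) *: 'X^1
      + (- a ^+ 4) *: 'X^0.
  by rewrite e12; euler_ring.
have e20 : forest_poly_exp 2 a =
     (5 * a) *: 'X^5 + (a ^+ 2 - 14 * a) *: 'X^4 + (- (4 * a ^+ 2) + 13 * a) *: 'X^3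
      + (6 * a ^+ 2 - 4 * a) *: 'X^2 + (- (4 * a ^+ 2)) *: 'X^1 + (a ^+ 2) *: 'X^0.
  by rewrite forest_poly_expE /= -!mul_polyC; ring.
have e21 : euler_op a (forest_poly_exp 2 a) =
     (25 * a) *: 'X^7 + (9 * a ^+ 2 - 81 * a) *: 'X^6
      + (a ^+ 3 - 35 * a ^+ 2 + 95 * a) *: 'X^5
      + (- (5 * a ^+ 3) + 51 * a ^+ 2 - 47 * a) *: 'X^4
      + (10 * a ^+ 3 - 33 * a ^+ 2 + 8 * a) *: 'X^3
      + (- (10 * a ^+ 3) + 8 * a ^+ 2) *: 'X^2 + (5 * a ^+ 3) *: 'X^1
      + (- a ^+ 3) *: 'X^0.
  by rewrite e20; euler_ring.
have e22 : euler_op a (euler_op a (forest_poly_exp 2 a)) =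
     ((10 ^+ 2 + 75) * a) *: 'X^9 + (79 * a ^+ 2 - (6 * 10 ^+ 2 + 61) * a) *: 'X^8
      + (14 * a ^+ 3 - (3 * 10 ^+ 2 + 35) * a ^+ 2 + (9 * 10 ^+ 2 + 61) * a) *: 'X^7
      + (a ^+ 4 - 69 * a ^+ 3 + (5 * 10 ^+ 2 + 55) * a ^+ 2 - (6 * 10 ^+ 2 + 63) * a) *: 'X^6
      + (- (6 * a ^+ 4) + (10 ^+ 2 + 36) * a ^+ 3 - (4 * 10 ^+ 2 + 45) * a ^+ 2
           + (2 * 10 ^+ 2 + 12) * a) *: 'X^5
      + (15 * a ^+ 4 - (10 ^+ 2 + 34) * a ^+ 3 + (10 ^+ 2 + 70) * a ^+ 2 - 24 * a) *: 'X^4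
      + (- (20 * a ^+ 4) + 66 * a ^+ 3 - 24 * a ^+ 2) *: 'X^3
      + (15 * a ^+ 4 - 13 * a ^+ 3) *: 'X^2 + (- (6 * a ^+ 4)) *: 'X^1
      + (a ^+ 4) *: 'X^0.
  by rewrite e21; euler_ring.
have e30 : forest_poly_exp 3 a =
     (90 * a) *: 'X^8 + (15 * a ^+ 2 - (3 * 10 ^+ 2 + 53) * a) *: 'X^7
      + (a ^+ 3 - 72 * a ^+ 2 + (5 * 10 ^+ 2 + 36) * a) *: 'X^6
      + (- (6 * a ^+ 3) + (10 ^+ 2 + 38) * a ^+ 2 - (3 * 10 ^+ 2 + 89) * a) *: 'X^5
      + (15 * a ^+ 3 - (10 ^+ 2 + 32) * a ^+ 2 + (10 ^+ 2 + 32) * a) *: 'X^4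
      + (- (20 * a ^+ 3) + 63 * a ^+ 2 - 16 * a) *: 'X^3
      + (15 * a ^+ 3 - 12 * a ^+ 2) *: 'X^2 + (- (6 * a ^+ 3)) *: 'X^1
      + (a ^+ 3) *: 'X^0.
  by rewrite forest_poly_expE /= -!mul_polyC; ring.
have e31 : euler_op a (forest_poly_exp 3 a) =
     ((7 * 10 ^+ 2 + 20) * a) *: 'X^10
      + ((10 ^+ 2 + 95) * a ^+ 2 - (31 * 10 ^+ 2 + 91) * a) *: 'X^9
      + (21 * a ^+ 3 - (9 * 10 ^+ 2 + 80) * a ^+ 2 + (56 * 10 ^+ 2 + 87) * a) *: 'X^8
      + (a ^+ 4 - (10 ^+ 2 + 23) * a ^+ 3 + (20 * 10 ^+ 2 + 11) * a ^+ 2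
           - (51 * 10 ^+ 2 + 61) * a) *: 'X^7
      + (- (7 * a ^+ 4) + (3 * 10 ^+ 2) * a ^+ 3 - (21 * 10 ^+ 2 + 43) * a ^+ 2
           + (24 * 10 ^+ 2 + 73) * a) *: 'X^6
      + (21 * a ^+ 4 - (3 * 10 ^+ 2 + 90) * a ^+ 3 + (12 * 10 ^+ 2 + 38) * a ^+ 2
           - (5 * 10 ^+ 2 + 76) * a) *: 'X^5
      + (- (35 * a ^+ 4) + (2 * 10 ^+ 2 + 85) * a ^+ 3
           - (3 * 10 ^+ 2 + 61) * a ^+ 2 + 48 * a) *: 'X^4
      + (35 * a ^+ 4 - (10 ^+ 2 + 11) * a ^+ 3 + 40 * a ^+ 2) *: 'X^3
      + (- (21 * a ^+ 4) + 18 * a ^+ 3) *: 'X^2 + (7 * a ^+ 4) *: 'X^1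
      + (- a ^+ 4) *: 'X^0.
  by rewrite e30; euler_ring.
case: k lt5 => [|[|[|[|[|//]]]]] _;
  rewrite -(big_mkord xpredT (fun i => 'C(_, i)%:R *: iter i _ (forest_poly_exp (_ - i) a)));
  rewrite !big_nat_recr // big_geq // ?subSS ?subn0 ?(bin0, binn, bin1, bE) /=.
- rewrite e00 -!mul_polyC; ring.
- rewrite e01 e10 -!mul_polyC; ring.
- rewrite e02 e11 e20 -!mul_polyC; ring.
- rewrite e03 e12 e21 e30 -!mul_polyC; ring.
- rewrite e04 e13 e22 e31 forest_poly_expE /= -!mul_polyC; ring.
Qed.

End Bell.

(** * Closed form of the level moments *)

Section Closed.
Local Open Scope ring_scope.
Variable R : realFieldType.

Lemma lagrange_form_euler_iter (a : R) m i (g : {poly R}) :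
  m%:R ^+ i * lagrange_form (m%:R + a) m g
  = lagrange_form (m%:R + a) m (iter i (euler_op a) g).
Proof.
by elim: i => [|i IH]; rewrite ?mul1r // exprS -mulrA IH lagrange_form_euler.
Qed.

Lemma lagrange_form_forest_poly_exp (a b : R) m k :
  \sum_(j < m.+1) a ^+ j / j`!%:R * lagrange_form b (m - j) (forest_poly R k j)
  = lagrange_form (b + a) m (forest_poly_exp k a).
Proof.
rewrite lagrange_form_sum.
under [RHS]eq_bigr => r _ do rewrite lagrange_formZ -lagrange_form_ffact.
rewrite exchange_big; apply: eq_bigr => j _.
rewrite lagrange_form_sum mulr_sumr; apply: eq_bigr => r _.
by rewrite lagrange_formZ mulrA [_ * (j ^_ r)%:R]mulrC.
Qed.

Lemma forest_poly0 k : (k < 5)%N -> forest_poly R k 0 = (k == 0%N)%:R.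
Proof.
move=> lt5; rewrite forest_polyE polyC0 !mul0r !addr0.
by case: k lt5 => [|[|[|[|[|//]]]]].
Qed.

(** The constant term in u is the value at 'X = 1, where every [tree_poly] vanishes because of its
    factor 'X - 1. *)
Lemma forest_poly_at0 b k (a : nat) : (k < 5)%N ->
  lagrange_form b 0 (forest_poly R k a) = (k == 0%N)%:R.
Proof.
move=> lt5.
have h (g : {poly R}) : lagrange_form b 0 g = g.[1].
  elim/(@poly_lin_ind R): g => [g h eg eh|c g eg|n].
  - by rewrite lagrange_formD hornerD eg eh.
  - by rewrite lagrange_formZ hornerZ eg.
  - by rewrite lagrange_formXn expgeom_coef_at0 hornerXn expr1n.
rewrite h forest_polyE !(hornerD, hornerM) /=.
have X1 : ('X - 1).[1] = 0 :> R by rewrite hornerD hornerN hornerX hornerC subrr.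
have t1 i : (tree_poly R i).[1] = 0.
  by case: i => [|[|[|[|[|i]]]]]; rewrite ?horner0 // /tree_poly !hornerM X1 mulr0 ?mul0r.
have c1 r : (tree_bell_poly R k r).[1] = ((k == 0) && (r == 0))%N%:R.
  rewrite /tree_bell_poly.
  case: k lt5 => [|[|[|[|[|//]]]]] _; case: r => [|[|[|[|[|r]]]]];
  by rewrite ?(horner0, hornerC, t1, hornerD, hornerM, horner_exp, expr0n, mulr0, mul0r, addr0).
by rewrite !c1 !andbF andbT !mulr0 !addr0.
Qed.

(** Every occupied level contains a vertex, so m vertices reach at most height m and the bound m <=
    K makes the truncation harmless. *)
Lemma level_moment_exp K (a m k : nat) : (k < 5)%N -> (m <= K)%N ->
  @level_moment R K a m (fun x => x%:R ^+ k)
  = m`!%:R * lagrange_form (m%:R + a%:R) m (forest_poly R k a).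
Proof.
elim: K a m k => [|K IH] a m k k5.
  rewrite leqn0 => /eqP->; rewrite forest_poly_at0 // level_moment0r fact0 mul1r.
  by rewrite expr0n.
case: m => [_|m lemK].
  by rewrite forest_poly_at0 // level_moment0r fact0 mul1r expr0n.
rewrite forest_poly_rec // lagrange_form_sum mulr_sumr.
have step (j : 'I_m.+2) : @level_moment R K j (m.+1 - j) (fun x => (m.+1 + x)%:R ^+ k)
   = \sum_(i < k.+1) ('C(k, i)%:R * m.+1%:R ^+ i) *
       ((m.+1 - j)`!%:R * lagrange_form m.+1%:R (m.+1 - j) (forest_poly R (k - i) j)).
  have -> : @level_moment R K j (m.+1 - j) (fun x => (m.+1 + x)%:R ^+ k)
     = \sum_(i < k.+1) ('C(k, i)%:R * m.+1%:R ^+ i) *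
       @level_moment R K j (m.+1 - j) (fun x => x%:R ^+ (k - i)).
    rewrite -(@level_moment_sum R K j (m.+1 - j) k.+1 (fun i => 'C(k, i)%:R * m.+1%:R ^+ i)
                (fun i x => x%:R ^+ (k - i))).
    apply: eq_level_moment => x; rewrite addnC natrD exprDn; apply: eq_bigr => i _.
    by rewrite -mulr_natr; ring.
  apply: eq_bigr => i _; congr (_ * _).
  have ltki : (k - i < 5)%N by apply: leq_ltn_trans k5; exact: leq_subr.
  (* For j = 0 all m + 1 vertices remain, possibly more than [K], so the induction hypothesis may
     not apply. Both sides vanish: nothing hangs below an empty set of roots, and [u^(m+1)]
     e^((m+1)u) (1-u) = 0. *)
  case: (posnP j) => [->|j0].
    rewrite subn0 level_moment0l forest_poly0 //.
    case: (k - i)%N => [|n]; last by rewrite /= lagrange_form0 mulr0.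
    have -> : (0 == 0)%N%:R = 'X^0 :> {poly R} by [].
    rewrite lagrange_formXn; have := expgeom_coef_mulm 0 (0 : R) m.
    rewrite !mul0r !addr0 => /eqP.
    by rewrite mulf_eq0 (negPf (natrS_neq0 _ _)) /= => /eqP ->; rewrite mulr0.
  rewrite IH //; last by rewrite leq_subLR; lia.
  (* The exponent (m+1-j) + j is m+1 for every j, so all terms share the same argument b. *)
  by rewrite natrB ?subrK // -ltnS.
rewrite [LHS]/= (eq_bigr _ (fun j _ => congr1 _ (step j))).
under eq_bigr => j _ do rewrite mulr_sumr.
rewrite exchange_big; apply: eq_bigr => i _.
rewrite lagrange_formZ -lagrange_form_euler_iter -lagrange_form_forest_poly_exp.
rewrite !mulr_sumr; apply: eq_bigr => j _.
have lej : (j <= m.+1)%N by rewrite -ltnS.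
rewrite -(bin_fact lej) !natrM natrX.
have := natr_fact_neq0 R j.
move: j`!%:R => y y0; field.
by rewrite y0.
Qed.

End Closed.

(** * Counting trees by their height function *)

Section Levels.
Local Open Scope ring_scope.
Variables (R : realFieldType) (V : finType).
Implicit Types (S J : {set V}) (phi : nat -> R).

Definition level_support K (l : {ffun V -> 'I_K.+1}) : {set V} := [set v | l v != 0%N :> nat].

(* The number a of vertices of height 0 is passed separately: l vanishes on them,
   but also on the vertices that do not take part. *)
Definition parent_count K (a : nat) (l : {ffun V -> 'I_K.+1}) : nat :=
  (\prod_(v in level_support l)
    if l v == 1%N :> nat then a else #|[set u | (l u).+1 == l v :> nat]|)%N.

Definition level_sum K (a : nat) S phi : R :=
  \sum_(l : {ffun V -> 'I_K.+1} | level_support l == S)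
    (parent_count a l)%:R * phi (\sum_v l v)%N.

(** Undoes the peeling: [l] is a height function on S minus J and vanishes on J; adding 1 on all of
    S puts J at height 1. *)
Definition raise_level K S (l : {ffun V -> 'I_K.+1}) : {ffun V -> 'I_K.+2} :=
  [ffun v => inord (l v + (v \in S))].

Definition lower_level K (l : {ffun V -> 'I_K.+2}) : {ffun V -> 'I_K.+1} :=
  [ffun v => inord (l v).-1].

Lemma raise_levelE K S (l : {ffun V -> 'I_K.+1}) v :
  raise_level S l v = (l v + (v \in S))%N :> nat.
Proof. rewrite ffunE inordK //; have := ltn_ord (l v); case: (v \in S) => /=; lia. Qed.

Lemma lower_levelE K (l : {ffun V -> 'I_K.+2}) v : lower_level l v = (l v).-1 :> nat.
Proof. by rewrite ffunE inordK //; have := ltn_ord (l v); lia. Qed.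

Lemma sum_subsets_card S (g : nat -> R) :
  \sum_(J : {set V} | J \subset S) g #|J| = \sum_(j < #|S|.+1) 'C(#|S|, j)%:R * g j.
Proof.
rewrite (partition_big (fun J => inord #|J| : 'I_#|S|.+1) xpredT) //.
apply: eq_bigr => j _; rewrite -cards_draws.
rewrite (eq_bigl (fun J => J \in [set B : {set V} | B \subset S & #|B| == j])); last first.
  move=> J; rewrite !inE; case: (boolP (J \subset S)) => //= /subset_leq_card JS.
  by rewrite -val_eqE /= inordK // ltnS.
rewrite (eq_bigr (fun=> g j)) ?big_const ?iter_addr ?addr0 ?mulr_natl // => J.
by rewrite inE => /andP[_ /eqP ->].
Qed.

(** The left-hand side is the side condition that [reindex_onto] leaves in [level_sum_rec]. *)
Lemma level_support_raise K S J (l : {ffun V -> 'I_K.+1}) : J \subset S ->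
  ((level_support (raise_level S l) == S) && ([set v | raise_level S l v == 1%N :> nat] == J)
    && (lower_level (raise_level S l) == l)) = (level_support l == S :\: J).
Proof.
move=> /fintype.subsetP JS; apply/idP/eqP => [/andP[/andP[/eqP sS /eqP s1] /eqP lr]|sl].
  apply/setP => v; move/setP/(_ v): sS; move/setP/(_ v): s1; move/ffunP/(_ v): lr.
  move=> /(congr1 val) /=; rewrite lower_levelE !inE !raise_levelE; have := JS v.
  by case: (v \in S); case: (v \in J) => //=; lia.
have slv v : (l v != 0%N :> nat) = (v \notin J) && (v \in S).
  by move/setP/(_ v): sl; rewrite !inE.
rewrite -andbA; apply/and3P; split; apply/eqP.
- apply/setP => v; rewrite inE raise_levelE; have := slv v; have := JS v.
  by case: (v \in S); case: (v \in J) => //=; lia.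
- apply/setP => v; rewrite inE raise_levelE; have := slv v; have := JS v.
  by case: (v \in S); case: (v \in J) => //=; lia.
- apply/ffunP => v; apply/val_inj; rewrite /= lower_levelE raise_levelE.
  have := slv v; have := JS v.
  by case: (v \in S); case: (v \in J) => //=; lia.
Qed.

(** Each vertex of J chooses among the a roots; a vertex raised to height 2 chooses in J, so J takes
    over the role of the set of roots for [l]. *)
Lemma parent_count_raise K a S J (l : {ffun V -> 'I_K.+1}) : J \subset S ->
  level_support l = S :\: J ->
  parent_count a (raise_level S l) = (a ^ #|J| * parent_count #|J| l)%N.
Proof.
move=> JS sl.
have [/andP[/eqP sS /eqP s1] _] : (level_support (raise_level S l) == S)
  && ([set v | raise_level S l v == 1%N :> nat] == J)
  /\ lower_level (raise_level S l) == l.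
  by apply/andP; rewrite level_support_raise // sl.
rewrite /parent_count sS sl (big_setID J) /= (setIidPr JS); congr (_ * _)%N.
  rewrite (eq_bigr (fun=> a)) ?prod_nat_const // => v; rewrite -{1}s1 inE => /eqP ->.
  by [].
apply: eq_bigr => v; rewrite -sl inE => lv.
have vS : v \in S by move: lv (sl) => lv /setP/(_ v); rewrite !inE lv => /esym/andP[].
rewrite raise_levelE vS addn1; move: lv; case e : (l v : nat) => [//|k] _ /=.
case: k e => [|k] e /=.
  by rewrite -s1; apply: eq_card => u; rewrite !inE eqSS.
apply: eq_card => u; rewrite !inE raise_levelE !eqSS.
move/setP/(_ u): sl; rewrite !inE.
by case: (u \in S); rewrite ?addn1 ?addn0 //= andbF => /negbFE/eqP ->.
Qed.

Lemma level_sum_rec K a S phi :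
  level_sum K.+1 a S phi
  = \sum_(J : {set V} | J \subset S)
      (a ^ #|J|)%:R * level_sum K #|J| (S :\: J) (fun x => phi (#|S| + x)%N).
Proof.
rewrite /level_sum.
rewrite (partition_big (fun l : {ffun V -> 'I_K.+2} => [set v | l v == 1%N :> nat])
  (fun J => J \subset S)).
  apply: eq_bigr => J JS; rewrite (reindex_onto (raise_level S) (@lower_level K)); last first.
    move=> l /andP[/eqP sl _]; apply/ffunP => v; apply/val_inj.
    rewrite /= raise_levelE lower_levelE; move/setP/(_ v): sl; rewrite inE => <-.
    by case: (nat_of_ord (l v)) => //= k; rewrite addn1.
  rewrite (eq_bigl _ _ (fun l => level_support_raise l JS)) mulr_sumr.
  apply: eq_bigr => l /eqP sl; rewrite (parent_count_raise _ JS sl) natrM mulrA.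
  congr (_ * phi _); rewrite (eq_bigr _ (fun v _ => raise_levelE S l v)).
  by rewrite big_split /= addnC -sum1_card [in RHS]big_mkcond.
move=> l /eqP <-; apply/fintype.subsetP => v; rewrite !inE.
by move=> /eqP ->.
Qed.

Lemma level_sumE K a S phi : level_sum K a S phi = level_moment K a #|S| phi.
Proof.
elim: K a S phi => [|K IH] a S phi; last first.
  rewrite level_sum_rec /=.
  under eq_bigr => J JS do rewrite IH cardsD (setIidPr JS).
  rewrite (sum_subsets_card S (fun j => (a ^ j)%:R * level_moment K j (#|S| - j)
     (fun x => phi (#|S| + x)%N))).
  by apply: eq_bigr => j _; rewrite natrM mulrA.
have l0 (l : {ffun V -> 'I_1}) : l = [ffun=> ord0].
  by apply/ffunP => v; rewrite ffunE ord1.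
have s0 : level_support [ffun=> ord0 : 'I_1] = set0.
  by apply/setP => v; rewrite !inE ffunE.
rewrite /level_sum /= cards_eq0; case: (eqVneq S finset.set0) => [->|S0]; last first.
  by rewrite mul0r big_pred0 // => l; rewrite (l0 l) s0 eq_sym (negPf S0).
rewrite (big_pred1 [ffun=> ord0]) => [|l]; last by rewrite (l0 l) s0 /= !eqxx.
rewrite /parent_count s0 big_set0 !mul1r.
by rewrite big1 // => v _; rewrite ffunE.
Qed.

End Levels.

(** * Trees with a prescribed height function *)

Section CountTrees.
Variables (n : nat) (r : 'I_n).
Implicit Types (G : {set {set 'I_n}}) (l : {ffun 'I_n -> 'I_n.+1}).

(** The codomain contains n, the default distance, so that no height is truncated for any graph. *)
Definition height_fun G : {ffun 'I_n -> 'I_n.+1} := [ffun v => inord (graph_dist G v r)].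

Lemma height_funE G v : height_fun G v = graph_dist G v r :> nat.
Proof. by rewrite ffunE inordK // ltnS; exact: bigminn_le_idx. Qed.

Lemma graph_dist_eq0 G v : (graph_dist G v r == 0) = (v == r).
Proof.
apply/idP/idP => [/eqP d0|/eqP ->]; last first.
  by rewrite -leqn0; exact: (@graph_dist_le_walk _ G r r [::]).
have n0 : 0 < n by case: n r => // - [].
have : graph_dist G v r < n by rewrite d0.
move=> /bigminn_attained[k /existsP[t /andP[_ lt]]].
rewrite -[X in X = _]/(graph_dist G v r) d0 => k0; move: t lt; rewrite -k0 => t.
by rewrite (tuple0 t).
Qed.

Lemma level_support_height_fun G : level_support (height_fun G) = [set~ r].
Proof. by apply/setP => v; rewrite !inE height_funE graph_dist_eq0. Qed.

Lemma graph_dist_edge G u v : connected_graph G -> edge_rel G v u ->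
  graph_dist G v r <= (graph_dist G u r).+1.
Proof.
move=> cG vu; have [q [eq lq <-]] := graph_dist_walk u r cG.
by apply: (@graph_dist_le_walk _ G v r (u :: q)); rewrite /= ?vu.
Qed.

Lemma graph_dist_parent G v : connected_graph G -> v != r ->
  exists2 u, edge_rel G v u & (graph_dist G u r).+1 = graph_dist G v r.
Proof.
move=> cG vr; have [[|u q] [/= eq lq sq]] := graph_dist_walk v r cG.
  by rewrite lq eqxx in vr.
move: eq => /andP[vu uq]; exists u => //; apply/eqP; rewrite eqn_leq.
by rewrite graph_dist_edge // andbT -sq ltnS (graph_dist_le_walk uq).
Qed.

(** The root is its own dummy parent, which makes the function attached to a tree unique. *)
Definition parent_choices l v : pred 'I_n :=
  fun u => if v == r then u == r else (l u).+1 == l v :> nat.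

Lemma card_parent_choices l : level_support l = [set~ r] ->
  #|family (parent_choices l)| = parent_count 1 l.
Proof.
move=> sl; rewrite card_family.
rewrite foldrE big_map /parent_count sl [RHS]big_mkcond /= big_enum /=.
apply: eq_bigr => v _; rewrite !inE; case: eqVneq => [->|vr] /=.
  rewrite -(card1 r); apply: eq_card => u.
  by rewrite unfold_in /parent_choices eqxx inE.
have lE u : (l u == 0 :> nat) = (u == r).
  by apply: negb_inj; move/setP/(_ u): sl; rewrite !inE.
case: ifP => [/eqP l1|_].
  rewrite -(card1 r); apply: eq_card => u.
  by rewrite unfold_in /parent_choices (negPf vr) l1 eqSS lE inE.
by apply: eq_card => u; rewrite unfold_in /parent_choices (negPf vr) inE.
Qed.

(** Sending a parent function to its graph is a bijection onto these trees. It is injective because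
    an edge determines which end is the parent: the lower one. It is onto because in a tree every
    vertex other than the root has a neighbour one level below. *)
Lemma card_trees_height_fun l : level_support l = [set~ r] ->
  #|[set G | `[< is_tree G >] & height_fun G == l]| = parent_count 1 l.
Proof.
move=> sl; rewrite -card_parent_choices //.
have lr : l r = 0 :> nat by apply/eqP; apply: negbFE; move/setP/(_ r): sl; rewrite !inE eqxx.
have lp (p : {ffun 'I_n -> 'I_n}) : p \in family (parent_choices l) ->
    forall v, v != r -> (l (p v)).+1 = l v.
  move=> /familyP fp v vr; have := fp v.
  by rewrite unfold_in /parent_choices (negPf vr) => /eqP.
have inj : {in family (parent_choices l) &,
    injective (fun p : {ffun 'I_n -> 'I_n} => parent_graph r p)}.
  move=> p q fp fq e; apply/ffunP => v.
  case: (eqVneq v r) => [->|vr].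
    have /familyP/(_ r) := fp; have /familyP/(_ r) := fq.
    by rewrite !unfold_in /parent_choices eqxx => /eqP -> /eqP ->.
  have : edge_rel (parent_graph r p) v (p v).
    by apply/(@edge_parent_graphP _ r (fun v => l v) p lr (lp _ fp)); left.
  rewrite e => /(@edge_parent_graphP _ r (fun v => l v) q lr (lp _ fq) _ _) -[[_ //]|[pvr vE]].
  move: (lp _ fp _ vr) (lp _ fq _ pvr); rewrite -vE.
  by move: (nat_of_ord (l v)) (nat_of_ord (l (p v))) => a b; lia.
rewrite -(card_in_imset inj); apply: eq_card => G; rewrite inE.
apply/idP/imsetP => [/andP[/asboolP tG /eqP hG]|[p fp ->]]; last first.
  apply/andP; split.
    by apply/asboolP; exact: (@parent_graph_tree _ r (fun v => l v) p lr (lp _ fp)).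
  apply/eqP/ffunP => v; apply/val_inj.
  by rewrite /= height_funE (@parent_graph_dist _ r (fun v => l v) p lr (lp _ fp)).
have cG : connected_graph G by case: tG.
have ex v : exists u, if v == r then u == r else edge_rel G v u && ((l u).+1 == l v :> nat).
  case: eqVneq => [_|vr]; first by exists r.
  have [u vu hu] := graph_dist_parent cG vr; exists u.
  by rewrite vu -hG !height_funE hu /=.
pose p := [ffun v => xchoose (ex v)].
have pP v : if v == r then p v == r else edge_rel G v (p v) && ((l (p v)).+1 == l v :> nat).
  by rewrite ffunE; exact: (xchooseP (ex v)).
have fp : p \in family (parent_choices l).
  apply/familyP => v; have := pP v; rewrite unfold_in /parent_choices.
  by case: ifP => // _ /andP[].
exists p => //; apply: (@tree_eq_parent_graph _ r (fun v => l v) p lr (lp _ fp) _ tG) => v vr.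
by have := pP v; rewrite (negPf vr) => /andP[].
Qed.

End CountTrees.

(** Each of the n roots contributes the same amount, that of n - 1 vertices below a single root; the
    level bound n comes from the codomain of [height_fun]. *)
Lemma sum_rooted_trees (R : realFieldType) (n : nat) (phi : nat -> R) :
  (\sum_(t in rooted_trees n) phi (total_height t)
   = n%:R * level_moment n 1 n.-1 phi)%R.
Proof.
rewrite (eq_bigl (fun t : {set {set 'I_n}} * 'I_n => `[< is_tree t.1 >] && true)); last first.
  by move=> t; rewrite inE andbT.
rewrite -(pair_big_dep (fun G : {set {set 'I_n}} => `[< is_tree G >]) (fun _ _ => true)
  (fun G r => phi (\sum_(v : 'I_n) graph_dist G v r)%N)) /=.
rewrite exchange_big /=.
rewrite (eq_bigr (fun=> level_moment n 1 n.-1 phi)); last first.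
  move=> r _.
  rewrite (partition_big (height_fun r) (fun l => level_support l == [set~ r])); last first.
    by move=> G _; rewrite level_support_height_fun.
  have <- : #|[set~ r]| = n.-1 by rewrite cardsC1 card_ord.
  rewrite -level_sumE; apply: eq_bigr => l /eqP sl.
  rewrite -(card_trees_height_fun sl) -sum1_card natr_sum mulr_suml.
  apply: eq_big => [G|G /andP[_ /eqP <-]]; first by rewrite inE.
  rewrite mul1r; congr (phi _); apply: eq_bigr => v _.
  by rewrite height_funE.
by rewrite sumr_const card_ord mulr_natl.
Qed.

(** * Exact moments *)

Local Open Scope ring_scope.

(* Numerals above 5000 stand for [Nat.of_num_uint] of their digits; this evaluates
   them without computing a unary natural. *)
Fixpoint decimal_value (R : nzRingType) (d : Decimal.uint) (a : R) : R :=
  match d with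
  | Decimal.Nil => a
  | Decimal.D0 d => decimal_value d (10 * a)
  | Decimal.D1 d => decimal_value d (10 * a + 1)
  | Decimal.D2 d => decimal_value d (10 * a + 2)
  | Decimal.D3 d => decimal_value d (10 * a + 3)
  | Decimal.D4 d => decimal_value d (10 * a + 4)
  | Decimal.D5 d => decimal_value d (10 * a + 5)
  | Decimal.D6 d => decimal_value d (10 * a + 6)
  | Decimal.D7 d => decimal_value d (10 * a + 7)
  | Decimal.D8 d => decimal_value d (10 * a + 8)
  | Decimal.D9 d => decimal_value d (10 * a + 9)
  end.

Lemma tail_mulE m n : Nat.tail_mul m n = (m * n)%N.
Proof.
have addE k l : Nat.tail_add k l = (k + l)%N.
  by elim: k l => //= k IH l; rewrite IH addnS.
rewrite /Nat.tail_mul -[RHS]/(0 + _)%N; elim: m 0%N => [|m IH] r /=; first by rewrite addn0.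
by rewrite IH addE mulSn addnA [(r + n)%N]addnC.
Qed.

Lemma natr_of_num_uint (R : nzRingType) (d : Decimal.uint) :
  (Nat.of_num_uint (Number.UIntDecimal d))%:R = decimal_value d (0 : R).
Proof.
rewrite /Nat.of_num_uint /Nat.of_uint -[0 in RHS]/(0%:R : R).
elim: d 0%N => //= d IH a; rewrite {}IH tail_mulE;
  congr (decimal_value d _); by rewrite -natrM -?natrD ?natr1 // addnC.
Qed.

Section Moments.
Variable R : realType.

(* The ratio of expgeom_coef i to expgeom_coef 0, at b = n and m = n - 1. *)
Fixpoint cayley_coef (N w : R) (i : nat) : R :=
  match i with
  | 0%N => 1
  | 1%N => N
  | (i'.+1 as j).+1 =>
      if i' is i''.+1
      then (i''%:R * cayley_coef N w j + N * cayley_coef N w i') / i'%:R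
      else w + N
  end.

(** Subtract the derivative formulas for i + 1 and i: because b = m + 1, the partial sum relation
    eliminates all coefficients of index m + 1. The case i = 0 relates the first two numbers. *)
Lemma expgeom_coef_rec i m (N : R) : N = m.+1%:R ->
  i%:R * expgeom_coef i.+2 N m
  = (i%:R - 1) * expgeom_coef i.+1 N m + N * expgeom_coef i N m.
Proof.
move=> NE; have := expgeom_coef_deriv i.+1 N m; have := expgeom_coef_deriv i N m.
rewrite -NE expgeom_coefS mulrDr => ->; rewrite -[i.+1%:R]natr1.
by move: (expgeom_coef _ _ _) => x; lra.
Qed.

Lemma expgeom_coef_cayley i m (N : R) : N = m.+1%:R ->
  expgeom_coef i N m = cayley_coef N (W R m.+1) i * expgeom_coef 0 N m.
Proof.
move=> NE; set w := W R m.+1.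
have N0 : N != 0 by rewrite NE natrS_neq0.
have b1 : expgeom_coef 1 N m = N * expgeom_coef 0 N m.
  have := expgeom_coef_rec 0 NE; rewrite mul0r sub0r mulN1r => /esym/eqP.
  by rewrite addrC subr_eq0 => /eqP.
(* The number for i = 2 is the truncated exponential sum of n^t/t! over t <= n - 1. Its last term
   gives N and the rest is the sum in W, whose prefactor n!/n^(n-1) is exactly the inverse of the
   number for i = 0. *)
have b2 : expgeom_coef 2 N m = (w + N) * expgeom_coef 0 N m.
  have -> : expgeom_coef 2 N m = \sum_(t < m.+1) expgeom_coef 1 N t by [].
  rewrite mulrDl -b1 /w /W /= big_ord_recr /= -NE; congr (_ + _).
  under [LHS]eq_bigr => t _ do rewrite expgeom_coef1.
  rewrite mulrAC; rewrite -[LHS]mul1r; congr (_ * _).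
  have -> : expgeom_coef 0 N m = expgeom_coef 1 N m / N.
    by rewrite b1 mulrAC mulfV // mul1r.
  rewrite expgeom_coef1 factS natrM -NE; have := natr_fact_neq0 R m => f0.
  have : N ^+ m != 0 by rewrite expf_neq0.
  by move: (N ^+ m) => x x0; field; rewrite f0 x0 N0.
elim/ltn_ind: i => -[|[|[|i]]] IH //=; first by rewrite mul1r.
have i0 := natrS_neq0 R i.
apply: (mulfI i0); rewrite (expgeom_coef_rec _ NE) -[in X in X * _ + _]natr1 addrK.
rewrite (IH i.+2) // (IH i.+1) //=.
by move: i.+1%:R i0 (expgeom_coef 0 N m) => x x0 y; field.
Qed.

(** The k-th moments of the total height, the last branch being k = 4; in particular w is the mean.
    All are affine in w, so the higher powers of w in the fourth central moment come from powers of
    the mean. *)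
Definition raw_moment (N w : R) (k : nat) : R :=
  match k with
  | 0%N => 1
  | 1%N => w
  | 2%N => - (17 / 6) * N * w + 5 / 3 * N ^+ 3 - 5 / 3 * N ^+ 2
  | 3%N => 15 / 8 * N ^+ 3 * w + (10 ^+ 2 + 57) / 24 * N ^+ 2 * w - 1 / 60 * N * w
      - (10 ^+ 2 + 51) / 30 * N ^+ 4 + 76 / 15 * N ^+ 3 - 1 / 30 * N ^+ 2
  | _ => - ((5 * 10 ^+ 2 + 77) / 48) * N ^+ 4 * w
      - (61 * 10 ^+ 2 + 21) / (4 * 10 ^+ 2 + 32) * N ^+ 3 * w
      + 97 / (25 * 10 ^+ 2 + 20) * N ^+ 2 * w + 1 / (10 ^+ 2 + 5) * N * w
      + (2 * 10 ^+ 2 + 21) / 63 * N ^+ 6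
      + (46 * 10 ^+ 2 + 93) / (5 * 10 ^+ 2 + 40) * N ^+ 5
      - (46 * 10 ^+ 2 + 51) / (3 * 10 ^+ 2 + 78) * N ^+ 4
      + (10 ^+ 2 + 9) / (12 * 10 ^+ 2 + 60) * N ^+ 3 + 2 / (10 ^+ 2 + 5) * N ^+ 2
  end.

Lemma lagrange_form_forest_poly1 m k (N : R) : (k < 5)%N -> N = m.+1%:R ->
  lagrange_form N m (forest_poly R k 1)
  = raw_moment N (W R m.+1) k * expgeom_coef 0 N m.
Proof.
move=> k5 NE; set w := W R m.+1.
have L (c : {poly R}) : forall d : nat -> R, c = \sum_(i < 12) d i *: 'X^i ->
    lagrange_form N m c = \sum_(i < 12) d i * cayley_coef N w i * expgeom_coef 0 N m.
  move=> d ->; rewrite lagrange_form_sum; apply: eq_bigr => i _.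
  by rewrite lagrange_formZ lagrange_formXn (expgeom_coef_cayley _ NE) mulrA.
(* The falling factorials of a = 1 vanish from r = 2 on. The lists below hold the coefficients of
   this polynomial by increasing degree, which is at most 11. *)
have fE : forest_poly R k 1 = tree_bell_poly R k 0 + 'X * tree_bell_poly R k 1.
  by rewrite forest_polyE polyC1 subrr mulr0 !mul0r !addr0 mul1r.
pose d : seq R := nth [::] [:: [:: 1]; [:: 0; -1; 1]; [:: 0; 0; 0; 4; -9; 5];
  [:: 0; 0; 0; 0; 16; - (10 ^+ 2 + 16); 2 * 10 ^+ 2 + 73; - (2 * 10 ^+ 2 + 63); 90];
  [:: 0; 0; 0; 0; 0; 96; - (14 * 10 ^+ 2 + 46); 73 * 10 ^+ 2 + 51;
      - (10 ^+ 4 + 75 * 10 ^+ 2 + 75); 2 * 10 ^+ 4 + 17 * 10 ^+ 2 + 15;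
      - (10 ^+ 4 + 34 * 10 ^+ 2 + 56); 33 * 10 ^+ 2 + 15]] k.
rewrite fE (L _ (nth 0 d)) {L fE}; last first.
  rewrite /d => {d}; case: k k5 => [|[|[|[|[|//]]]]] _; rewrite !big_ord_recr big_ord0 /=;
    rewrite ?scale0r ?addr0 ?add0r -?mul_polyC /tree_poly; ring.
rewrite -mulr_suml; congr (_ * _); rewrite /d => {d}.
by case: k k5 => [|[|[|[|[|//]]]]] _; rewrite !big_ord_recr big_ord0 /=; field.
Qed.

(** The number of trees is the case k = 0 of the same sum, so the common factor cancels once it is
    known to be nonzero. *)
Lemma height_raw_moment n k : (0 < n)%N -> (k < 5)%N ->
  unif_expectation (rooted_trees n) (fun t => @height_rv R n t ^+ k)
  = raw_moment n%:R (W R n) k.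
Proof.
case: n => [//|m] _ k5.
have sumE j : (j < 5)%N -> \sum_(t in rooted_trees m.+1) @height_rv R _ t ^+ j
    = m.+1%:R * m`!%:R * expgeom_coef 0 m.+1%:R m * raw_moment m.+1%:R (W R m.+1) j.
  move=> j5; rewrite (sum_rooted_trees m.+1 (fun x => x%:R ^+ j)).
  rewrite level_moment_exp // -?natrD ?addn1 //.
  rewrite (lagrange_form_forest_poly1 j5 erefl).
  by rewrite !mulrA mulrAC.
have cE : #|rooted_trees m.+1|%:R = m.+1%:R * m`!%:R * expgeom_coef 0 m.+1%:R m :> R.
  by rewrite -[RHS]mulr1 -(sumE 0%N) // -sum1_card natr_sum; apply: eq_bigr => t _; rewrite expr0.
rewrite /unif_expectation sumE // cE mulrAC mulfV ?mul1r //.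
have := natrS_neq0 R m; have := natr_fact_neq0 R m => f0 N0.
rewrite !mulf_neq0 //; apply/eqP => e0.
have := expgeom_coef_rec 0 (erefl (m.+1%:R : R)).
rewrite e0 mulr0 addr0 mul0r sub0r mulN1r => /esym/eqP.
by rewrite oppr_eq0 expgeom_coef1 mulf_eq0 invr_eq0 (negPf f0) expf_eq0 (negPf N0) andbF.
Qed.

Lemma unif_central_moment2 (T : finType) (A : {set T}) (X : T -> R) : (0 < #|A|)%N ->
  unif_central_moment A 2 X
  = unif_expectation A (fun t => X t ^+ 2) - unif_expectation A X ^+ 2.
Proof.
move=> A0; rewrite /unif_central_moment; set e := unif_expectation A X.
have c0 : #|A|%:R != 0 :> R by rewrite pnatr_eq0 -lt0n.
have eE : \sum_(t in A) X t = e * #|A|%:R by rewrite /e /unif_expectation mulfVK.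
rewrite /unif_expectation.
rewrite (eq_bigr (fun t => X t ^+ 2 - (2 * e) * X t + e ^+ 2)); last by move=> t _; ring.
rewrite !big_split /= sumrN -mulr_sumr eE sumr_const.
by rewrite -[_ *+ _]mulr_natr; field.
Qed.

Lemma unif_central_moment4 (T : finType) (A : {set T}) (X : T -> R) : (0 < #|A|)%N ->
  let E k := unif_expectation A (fun t => X t ^+ k) in
  unif_central_moment A 4 X
  = E 4%N - 4 * E 1%N * E 3%N + 6 * E 1%N ^+ 2 * E 2%N - 3 * E 1%N ^+ 4.
Proof.
move=> A0 E; rewrite /unif_central_moment -[unif_expectation A X]/(E 1%N).
have c0 : #|A|%:R != 0 :> R by rewrite pnatr_eq0 -lt0n.
have eE k : \sum_(t in A) X t ^+ k = E k * #|A|%:R by rewrite /E /unif_expectation mulfVK.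
rewrite /unif_expectation.
rewrite (eq_bigr (fun t => X t ^+ 4 - (4 * E 1%N) * X t ^+ 3 + (6 * E 1%N ^+ 2) * X t ^+ 2
  - (4 * E 1%N ^+ 3) * X t ^+ 1 + E 1%N ^+ 4)); last by move=> t _; ring.
rewrite !big_split /= !sumrN -!mulr_sumr !eE sumr_const.
by rewrite -[_ *+ _]mulr_natr; field.
Qed.

(** On an empty set the expectation of 1 would be 0, by the convention on division by zero, whereas
    the zeroth moment is 1. *)
Lemma rooted_trees_gt0 n : (0 < n)%N -> (0 < #|rooted_trees n|)%N.
Proof.
move=> n0; rewrite lt0n; apply: contraTneq (erefl true) => c0.
have := @height_raw_moment n 0 n0 isT; rewrite /unif_expectation c0 invr0 mulr0 /=.
by move=> /eqP; rewrite eq_sym oner_eq0.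
Qed.

Lemma height_varE n : (0 < n)%N -> let N : R := n%:R in let w := W R n in
  height_var R n = 5 / 3 * N ^+ 3 - 5 / 3 * N ^+ 2 - 17 / 6 * N * w - w ^+ 2.
Proof.
move=> n0 N w; rewrite /height_var /unif_variance unif_central_moment2 ?rooted_trees_gt0 //.
rewrite height_raw_moment //.
have -> : unif_expectation (rooted_trees n) (@height_rv R n) = w.
  exact: (@height_raw_moment n 1 n0 isT).
by rewrite -/N -/w /=; field.
Qed.

Lemma height_mu4E n : (0 < n)%N -> let N : R := n%:R in let w : R := W R n in
  height_mu4 R n =
    - 3 * w ^+ 4 - 17 * N * w ^+ 3
    + (5 / 2 * N ^+ 3 - 217 / 6 * N ^+ 2 + 1 / 15 * N) * w ^+ 2
    + (649 / 80 * N ^+ 4 - 74381%:R / 2160 * N ^+ 3 + 433 / 2520 * N ^+ 2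
       + 1 / 105 * N) * w
    + 221 / 63 * N ^+ 6 + 4693 / 540 * N ^+ 5 - 4651 / 378 * N ^+ 4
    + 109 / 1260 * N ^+ 3 + 2 / 105 * N ^+ 2.
Proof.
move=> n0 N w; rewrite /height_mu4 unif_central_moment4 ?rooted_trees_gt0 //.
rewrite !height_raw_moment // -/N -/w /=.
have -> : 74381%:R = 7 * 10 ^+ 4 + 43 * 10 ^+ 2 + 81 :> R.
  by apply: etrans (natr_of_num_uint R _) _; rewrite /decimal_value; ring.
by field.
Qed.

End Moments.

(** * Asymptotics of W *)

Section Wallis.
Variable R : realType.
Implicit Types (x : R).

Lemma nondecr_of_derive (f df : R -> R) (a b : R) : a <= b ->
  (forall x : R, is_derive x 1 f (df x)) ->
  (forall x, a < x < b -> 0 <= df x) -> f a <= f b.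
Proof.
move=> ab fdf df0.
have fcont : {within `[a, b], continuous f}%classic.
  apply: continuous_subspaceT => x; apply: differentiable_continuous.
  by apply/derivable1_diffP; exact: (@ex_derive _ _ _ _ _ _ _ (fdf x)).
case: (ltgtP a b) ab => // [ab _|-> //].
have [c cab] := MVT ab (fun x _ => fdf x) fcont.
move/eqP; rewrite subr_eq => /eqP ->; rewrite lerDr; apply: mulr_ge0; last first.
  by rewrite subr_ge0 ltW.
by apply: df0; move: cab; rewrite in_itv.
Qed.

(* The antiderivative of sin^n that vanishes at 0. *)
Fixpoint sin_prim (n : nat) : R -> R :=
  match n with
  | 0%N => fun x => x
  | 1%N => fun x => 1 - cos x
  | n'.+2 => fun x => (n'.+1%:R * sin_prim n' x - sin x ^+ n'.+1 * cos x) / n'.+2%:R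
  end.

Lemma is_derive_sin_prim n x : is_derive x 1 (sin_prim n) (sin x ^+ n).
Proof.
elim/ltn_ind: n => -[|[|n]] IH /=.
- rewrite expr0; exact: is_derive_id.
- by apply: is_derive_eq; ring.
have IHn := IH n (leqnSn n.+1).
have h : is_derive x 1 (n.+2%:R^-1 \*: (n.+1%:R \*: sin_prim n - (@sin R ^+ n.+1) * @cos R))
  (n.+2%:R^-1 *: (n.+1%:R *: (sin x ^+ n) -
    ((@sin R ^+ n.+1) x *: (- sin x) + cos x *: ((n.+1%:R * sin x ^+ n) *: cos x)))).
  by apply: is_deriveZ.
rewrite exprfctE /GRing.scale /= in h.
have n0 := natrS_neq0 R n.+1; rewrite -natr1 in n0 h *.
have -> : sin x ^+ n.+2 = (n.+1%:R + 1)^-1 * (n.+1%:R * sin x ^+ n -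
    (sin x ^+ n.+1 * (- sin x) + cos x * (n.+1%:R * sin x ^+ n * cos x))).
  rewrite !exprS; have cE : cos x * cos x = 1 - sin x * sin x.
    by have := cos2sin2 x; rewrite !expr2.
  rewrite [_ * (- sin x)]mulrN -![_ * cos x]mulrA [cos x * _]mulrC -!mulrA cE.
  by field.
congr (is_derive _ _ _ _) : h; apply/funext => y /=.
by rewrite [RHS]mulrC.
Qed.

Lemma sin_prim0 n : sin_prim n 0 = 0.
Proof.
elim/ltn_ind: n => -[|[|n]] IH //=; first by rewrite cos0 subrr.
by rewrite (IH n (leqnSn n.+1)) mulr0 sin0 expr0n mul0r subr0 mul0r.
Qed.

(* 4^m / 'C(2m, m) *)
Definition wallis (m : nat) : R := 4 ^+ m * m`!%:R ^+ 2 / (2 * m)`!%:R.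

Lemma wallis_gt0 m : 0 < wallis m.
Proof.
by rewrite /wallis !mulr_gt0 ?invr_gt0 ?exprn_gt0 ?ltr0n ?fact_gt0.
Qed.

Lemma wallisS m : wallis m.+1 = wallis m * ((2 * m.+1)%:R / (2 * m).+1%:R).
Proof.
rewrite /wallis mulnS !factS !natrM exprS.
have := natr_fact_neq0 R (2 * m); have := natrS_neq0 R m.
have := natrS_neq0 R (2 * m); have := natrS_neq0 R (2 * m).+1.
have -> : (2 * m).+2%:R = 2 * m.+1%:R :> R by rewrite -natrM mulnS.
move: m.+1%:R (2 * m).+1%:R (4 ^+ m) m`!%:R (2 * m)`!%:R => x y z t u _ y0 x0 u0.
by field; rewrite u0 y0 x0.
Qed.

Lemma sin_primSS n : sin_prim n.+2 (pi / 2) = n.+1%:R * sin_prim n (pi / 2) / n.+2%:R.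
Proof. by rewrite /= cos_pihalf mulr0 subr0. Qed.

Lemma sin_prim_even m : sin_prim (2 * m) (pi / 2) * wallis m = pi / 2.
Proof.
elim: m => [|m IH]; first by rewrite /wallis expr0 fact0 expr1n invr1 !mulr1.
rewrite -[RHS]IH wallisS mulnS sin_primSS.
have := natrS_neq0 R (2 * m); have := natrS_neq0 R (2 * m).+1.
move: (2 * m).+1%:R (2 * m).+2%:R => x y y0 x0.
by field; rewrite y0 x0.
Qed.

Lemma sin_prim_odd m : sin_prim (2 * m).+1 (pi / 2) * (2 * m).+1%:R = wallis m.
Proof.
elim: m => [|m IH].
  by rewrite /wallis expr0 fact0 expr1n invr1 !mulr1 /= cos_pihalf subr0.
rewrite wallisS -IH mulnS sin_primSS.
have := natrS_neq0 R (2 * m); have := natrS_neq0 R (2 * m).+2.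
move: (2 * m).+1%:R (2 * m).+2%:R (2 * m).+3%:R => x y z z0 x0.
by field; rewrite z0 x0.
Qed.

Lemma sin_prim_decr n : sin_prim n.+1 (pi / 2) <= sin_prim n (pi / 2).
Proof.
have pi0 := pi_gt0 R.
have : sin_prim n 0 - sin_prim n.+1 0 <= sin_prim n (pi / 2) - sin_prim n.+1 (pi / 2).
  apply: (@nondecr_of_derive (fun x => sin_prim n x - sin_prim n.+1 x)
    (fun x => sin x ^+ n - sin x ^+ n.+1)); first lra.
  - by move=> x; apply: is_deriveB; exact: is_derive_sin_prim.
  - move=> x /andP[x0 x1]; rewrite exprS -[X in X - _]mul1r -mulrBl.
    have s0 : 0 <= sin x by apply: ltW; apply: sin_gt0_pihalf; rewrite x0.
    by rewrite mulr_ge0 ?exprn_ge0 // subr_ge0 sin_le1.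
by rewrite !sin_prim0 subrr subr_ge0.
Qed.

(** With I_k the integral of sin^k over [0, pi/2], this is I_(2m+1) <= I_(2m); the lower bound that
    follows is I_(2m) <= I_(2m-1). *)
Lemma wallis_le m : 2 * wallis m ^+ 2 <= pi * (2 * m).+1%:R.
Proof.
have w0 := wallis_gt0 m; have m0 : 0 < (2 * m).+1%:R :> R by rewrite ltr0n.
have := sin_prim_even m; have := sin_prim_odd m; have := sin_prim_decr (2 * m).
move: (sin_prim _ _) (sin_prim _ _) (wallis m) w0 ((2 * m).+1%:R) m0 => b a w w0 x x0 ab aE bE.
have : a * x * w <= b * w * x by rewrite mulrAC (ler_pM2r x0) (ler_pM2r w0).
by rewrite aE bE; nra.
Qed.

Lemma wallis_ge m : pi * m%:R <= wallis m ^+ 2.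
Proof.
case: m => [|m]; first by rewrite mulr0 sqr_ge0.
have w0 := wallis_gt0 m.+1; have := sin_prim_even m.+1; have := sin_prim_odd m.
have := sin_prim_decr (2 * m).+1; rewrite -[X in X <= _]/(sin_prim (2 * m).+2 _).
have m0 : 0 < (2 * m).+1%:R :> R by rewrite ltr0n.
have wS : wallis m.+1 * (2 * m).+1%:R = wallis m * (2 * m.+1%:R).
  by rewrite wallisS -mulrA divfK ?gt_eqF // natrM.
rewrite mulnS; move: wS; have M0 : 0 < m.+1%:R :> R by rewrite ltr0n.
move: (sin_prim _ _) (sin_prim _ _) (wallis m) (wallis m.+1) w0 ((2 * m).+1%:R) m0 (m.+1%:R) M0.
move=> b a v w w0 x x0 M M0 wE ab bE aE.
have : a * w * M <= b * w * M by rewrite (ler_pM2r M0) (ler_pM2r w0).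
have -> : b * w * M = w ^+ 2 / 2.
  have x1 : x != 0 by rewrite gt_eqF.
  by apply: (mulfI x1); rewrite -bE in wE; nra.
by rewrite aE; lra.
Qed.

End Wallis.

(** * Falling factorial ratios, binomial ratios and sums of the latter *)

Section Compare.
Variable R : realType.

(* prod_(i < j) (1 - i / n) *)
Definition ffact_ratio (n j : nat) : R := (n ^_ j)%:R / n%:R ^+ j.

Definition bin_ratio (m j : nat) : R := 'C(2 * m, m + j)%:R / 'C(2 * m, m)%:R.

Lemma bin_ratio_ge0 m j : 0 <= bin_ratio m j.
Proof. by rewrite divr_ge0 ?ler0n. Qed.

Lemma ffact_ratio0 n : ffact_ratio n 0 = 1.
Proof. by rewrite /ffact_ratio expr0 divr1. Qed.

Lemma central_bin_neq0 m : 'C(2 * m, m)%:R != 0 :> R.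
Proof. by rewrite pnatr_eq0 -lt0n bin_gt0; lia. Qed.

Lemma bin_ratio0 m : bin_ratio m 0 = 1.
Proof. by rewrite /bin_ratio addn0 divff ?central_bin_neq0. Qed.

Lemma ffact_ratioS n j : (0 < n)%N ->
  n%:R * ffact_ratio n j.+1 = (n%:R - j%:R) * ffact_ratio n j.
Proof.
move=> n0; have N0 : n%:R != 0 :> R by rewrite pnatr_eq0 -lt0n.
have : n%:R ^+ j != 0 :> R by rewrite expf_neq0.
rewrite /ffact_ratio !natr_ffact big_ord_recr /= exprS.
by move: (\prod_(i < j) _) (n%:R ^+ j) => x y y0; field; rewrite y0 N0.
Qed.

Lemma bin_ratioS m j :
  (m%:R + j%:R + 1) * bin_ratio m j.+1 = (m%:R - j%:R) * bin_ratio m j.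
Proof.
rewrite /bin_ratio !mulrA; congr (_ / _).
rewrite -natrD natr1 -natrM addnS mul_bin_left natrM.
case: (leqP j m) => jm; last by rewrite bin_small ?mulr0 //; lia.
by rewrite -natrB //; congr (_%:R * _); lia.
Qed.

Lemma bin_ratio_big m j : (m < j)%N -> bin_ratio m j = 0.
Proof. by move=> mj; rewrite /bin_ratio bin_small ?mul0r //; lia. Qed.

Lemma ffact_ratio_big n j : (n < j)%N -> ffact_ratio n j = 0.
Proof. by move=> nj; rewrite /ffact_ratio ffact_small ?mul0r. Qed.

(** By symmetry, twice the upper half of row 2m is the whole row, 4^m, plus one more central
    coefficient. *)
Lemma sum_bin_ratio m : 2 * \sum_(j < m.+1) bin_ratio m j = 1 + wallis R m.
Proof.
have c0 := central_bin_neq0 m; rewrite /bin_ratio -mulr_suml.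
have cE : 'C(2 * m, m)%:R * m`!%:R ^+ 2 = (2 * m)`!%:R :> R.
  rewrite -natrX -natrM -(@bin_fact (2 * m) m); last lia.
  by congr (_%:R); rewrite expnS expn1; congr (_ * (_ * _`!))%N; lia.
have sE : 2 * \sum_(j < m.+1) 'C(2 * m, m + j)%:R = 4 ^+ m + 'C(2 * m, m)%:R :> R.
  have -> : 4 ^+ m = \sum_(0 <= i < (2 * m).+1) 'C(2 * m, i)%:R :> R.
    rewrite big_mkord -natr_sum.
    have -> : 4 = 2 ^+ 2 :> R by rewrite expr2 -natrM.
    rewrite -exprM -natrX; congr (_%:R).
    rewrite (expnDn 1 1); apply: eq_bigr => i _.
    by rewrite !exp1n !muln1.
  rewrite (@big_cat_nat _ _ _ m) //=; last lia.
  have -> : \sum_(m <= i < (2 * m).+1) 'C(2 * m, i)%:R = \sum_(j < m.+1) 'C(2 * m, m + j)%:R :> R.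
    rewrite -{1}[m]add0n big_addn big_mkord; have -> : ((2 * m).+1 - m)%N = m.+1 by lia.
    by apply: eq_bigr => i _; rewrite addnC.
  have -> : \sum_(0 <= i < m) 'C(2 * m, i)%:R = \sum_(j < m) 'C(2 * m, m + j.+1)%:R :> R.
    rewrite big_mkord (reindex_inj rev_ord_inj); apply: eq_bigr => i _ /=.
    by rewrite -bin_sub ?leq_subr; [congr ('C(_, _)%:R); have := ltn_ord i; lia | lia].
  by rewrite big_ord_recl addn0 /=; lra.
rewrite mulrA sE mulrDl divff // addrC /wallis -cE.
by have := natr_fact_neq0 R m => f0; congr (_ + _); field; rewrite c0 f0.
Qed.

(** Writing B_j for [bin_ratio m j], the recurrence reads 2 j B_j = (m+j) B_j - (m+j+1) B_(j+1),
    which telescopes. *)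
Lemma sum_bin_ratio_linear m : \sum_(j < m.+1) j%:R * bin_ratio m j = m%:R / 2.
Proof.
have h k : 2 * \sum_(j < k) j%:R * bin_ratio m j + k%:R * bin_ratio m k
    = m%:R * (1 - bin_ratio m k).
  elim: k => [|k IH]; first by rewrite big_ord0 bin_ratio0; ring.
  have := bin_ratioS m k; rewrite big_ord_recr /= -[k.+1%:R]natr1.
  by move: IH; move: (\sum_(j < k) _) => s IH e; lra.
by have := h m.+1; rewrite bin_ratio_big // !mulr0 subr0 mulr1 addr0 => <-; field.
Qed.

(** Summation by parts: from (m+j+1) B_(j+1) <= m B_j follows (j+1)^3 B_(j+1) <= m (j+1)^2 (B_j -
    B_(j+1)), and telescoping leaves the weights 2j + 1, whose sum is known from the linear case. *)
Lemma sum_bin_ratio_cubic m : \sum_(j < m.+1) j%:R ^+ 3 * bin_ratio m j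
  <= m%:R * (m%:R + \sum_(j < m.+1) bin_ratio m j).
Proof.
have h k : (k <= m)%N -> \sum_(j < k.+1) j%:R ^+ 3 * bin_ratio m j
      + m%:R * k%:R ^+ 2 * bin_ratio m k
    <= m%:R * \sum_(j < k) (2 * j%:R + 1) * bin_ratio m j.
  elim: k => [|k IH] km; first by rewrite big_ord1 big_ord0 !expr0n /= !mul0r !mulr0 mul0r addr0.
  rewrite big_ord_recr [in leRHS]big_ord_recr /= mulrDr.
  have := IH (ltnW km); have := bin_ratioS m k.
  have := bin_ratio_ge0 m k; have : 0 <= k%:R :> R by rewrite ler0n.
  rewrite -[k.+1%:R]natr1.
  move: (bin_ratio m k.+1) (bin_ratio m k) (k%:R) (m%:R) (\sum_(j < k.+1) _) (\sum_(j < k) _).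
  move=> b' b x M s s' x0 b0 e IH'.
  have : (x + 1) ^+ 2 * ((M + x + 1) * b') <= (x + 1) ^+ 2 * (M * b).
    by rewrite e ler_wpM2l ?sqr_ge0 // mulrBl gerBl mulr_ge0.
  by lra.
have := h m (leqnn m).
have := sum_bin_ratio_linear m; rewrite !big_ord_recr /= => lin.
have -> : \sum_(j < m) (2 * j%:R + 1) * bin_ratio m j
   = 2 * \sum_(j < m) j%:R * bin_ratio m j + \sum_(j < m) bin_ratio m j.
  by rewrite mulr_sumr -big_split; apply: eq_bigr => j _; rewrite /=; ring.
have := bin_ratio_ge0 m m; have : 0 <= m%:R :> R by rewrite ler0n.
move: lin; move: (\sum_(j < m) _) (\sum_(j < m) _) (\sum_(j < m) _) (bin_ratio m m) (m%:R).
move=> s1 s2 s3 b M e M0 b0 H.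
have : M * (2 * s3) <= M * M.
  by apply: ler_wpM2l => //; have := mulr_ge0 M0 b0; lra.
have := mulr_ge0 M0 b0; have := mulr_ge0 (sqr_ge0 M) b0.
have := mulr_ge0 M0 (mulr_ge0 (sqr_ge0 M) b0).
nra.
Qed.

End Compare.

(** * Growth of W *)

Section WAsymptotics.
Variable R : realType.
Local Notation A := (ffact_ratio R).
Local Notation B := (bin_ratio R).

(** The term k of W is n times the ratio at j = n - k >= 2; subtracting 2 removes j = 0 and j = 1.
    The terms with j > n vanish, and the range up to 2n matches that of the binomial ratios. *)
Lemma W_ffact_ratio n : (0 < n)%N ->
  W R n = n%:R * (\sum_(j < (2 * n).+1) A n j - 2).
Proof.
case: n => [//|m] _.
have -> : \sum_(j < (2 * m.+1).+1) A m.+1 j = \sum_(j < m.+2) A m.+1 j.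
  rewrite -!(big_mkord xpredT (A m.+1)) (@big_cat_nat _ _ _ m.+2) //=; last lia.
  by rewrite [X in _ + X]big_nat_cond [X in _ + X]big1 ?addr0 // => j /andP[/andP[jm _] _];
    exact: ffact_ratio_big.
have N0 := natrS_neq0 R m.
have -> : \sum_(j < m.+2) A m.+1 j = 2 + \sum_(j < m) A m.+1 j.+2.
  rewrite 2!big_ord_recl /= ffact_ratio0 addrA; congr (_ + _).
  by rewrite /ffact_ratio ffactn1 expr1 divff.
rewrite [2 + _]addrC addrK /W /= (reindex_inj rev_ord_inj) !mulr_sumr.
apply: eq_bigr => j _ /=; rewrite /ffact_ratio.
have jm := ltn_ord j.
have /(congr1 (fun x => x%:R : R)) : (m.+1 ^_ j.+2 * (m - j.+1)`! = m.+1`!)%N.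
  by rewrite -(@ffact_fact m.+1 j.+2) ?subSS //; lia.
rewrite natrM => <-.
have := natr_fact_neq0 R (m - j.+1).
have mE : m.+1%:R ^+ m = m.+1%:R ^+ (m - j.+1) * m.+1%:R ^+ j.+1 :> R.
  by rewrite -exprD subnK.
rewrite mE [_ ^+ j.+2]exprS.
move: (m.+1 ^_ j.+2)%:R (m - j.+1)`!%:R (m.+1%:R) N0 => z u t t0 u0.
have := expf_neq0 (m - j.+1) t0; have := expf_neq0 j.+1 t0.
move: (t ^+ (m - j.+1)) (t ^+ j.+1) => x y y0 x0.
by field; rewrite t0 x0 y0 u0.
Qed.

Section Fixed_n.
Variable n : nat.
Hypothesis n_gt0 : (0 < n)%N.
Let N : R := n%:R.

Let N_ge1 : 1 <= N. Proof. by rewrite ler1n. Qed.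

Let natr_2n : (2 * n)%:R = 2 * N :> R. Proof. by rewrite natrM. Qed.

(** One step multiplies the left side by (N-j)/N and the right side by (2N-j)/(2N+j); the second
    factor is the larger one, since N (2N-j) - (N-j)(2N+j) = j^2. *)
Lemma ffact_ratio_upper j : 2 * N * A n j <= (2 * N + j%:R) * B (2 * n) j.
Proof.
case: (leqP j n) => [|nj]; last first.
  by rewrite ffact_ratio_big // mulr0 mulr_ge0 ?bin_ratio_ge0 // addr_ge0 ?mulr_ge0.
elim: j => [|j IH] jn; first by rewrite ffact_ratio0 bin_ratio0 addr0.
have xN : j%:R + 1 <= N by rewrite natr1 ler_nat.
have x0 : 0 <= j%:R :> R by rewrite ler0n.
have := IH (ltnW jn); have := ffact_ratioS R j n_gt0; have := bin_ratioS R (2 * n) j.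
have := bin_ratio_ge0 R (2 * n) j.
rewrite natr_2n -[j.+1%:R]natr1 -/N.
move: (B _ j.+1) (B _ j) (A _ j.+1) (A _ j) (j%:R) xN x0 => b' b a' a x xN x0 b0 bE aE h.
have -> : (2 * N + (x + 1)) * b' = (2 * N - x) * b by rewrite -bE; ring.
have N0 : 0 < N by lra.
rewrite -(ler_pM2l N0).
have -> : N * (2 * N * a') = 2 * N * (N * a') by ring.
rewrite aE; have : (N - x) * (2 * N * a) <= (N - x) * ((2 * N + x) * b).
  by rewrite ler_wpM2l //; lra.
have : 0 <= x ^+ 2 * b by rewrite mulr_ge0 ?sqr_ge0.
lra.
Qed.

(** The excess j^2 in each step of the upper bound accumulates to at most order j^3, hence the cubic
    correction. For j > n the left side is not positive. *)
Lemma ffact_ratio_lower j :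
  (N ^+ 2 - 2 * j%:R ^+ 3) * B (2 * n) j <= N ^+ 2 * A n j.
Proof.
have N0 : 0 < N by have := N_ge1; lra.
case: (leqP j n) => [jn|nj]; last first.
  rewrite ffact_ratio_big // mulr0 mulr_le0_ge0 ?bin_ratio_ge0 //.
  have xN : N <= j%:R by rewrite ler_nat ltnW.
  have : N ^+ 3 <= j%:R ^+ 3 by rewrite lerXn2r ?nnegrE //; lra.
  have : N ^+ 2 * 1 <= N ^+ 2 * N by rewrite ler_wpM2l ?sqr_ge0.
  have := ltW N0; nra.
(* The induction runs on this sharper form; doubling j^3 afterwards pays for replacing 2N + j by
   2N. *)
have : (2 * N + j%:R) * (N ^+ 2 - j%:R ^+ 3) * B (2 * n) j <= 2 * N ^+ 3 * A n j.
  elim: j jn => [|j IH] jn.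
    by rewrite ffact_ratio0 bin_ratio0 expr0n /= addr0 subr0 !mulr1; lra.
  have xN : j%:R + 1 <= N by rewrite natr1 ler_nat.
  have x0 : 0 <= j%:R :> R by rewrite ler0n.
  have := IH (ltnW jn); have := ffact_ratioS R j n_gt0; have := bin_ratioS R (2 * n) j.
  have := bin_ratio_ge0 R (2 * n) j.
  rewrite natr_2n -[j.+1%:R]natr1 -/N.
  move: (B _ j.+1) (B _ j) (A _ j.+1) (A _ j) (j%:R) xN x0 => b' b a' a x xN x0 b0 bE aE h.
  have -> : (2 * N + (x + 1)) * (N ^+ 2 - (x + 1) ^+ 3) * b'
      = (N ^+ 2 - (x + 1) ^+ 3) * ((2 * N - x) * b) by rewrite -bE; ring.
  rewrite -(ler_pM2l N0).
  have -> : N * (2 * N ^+ 3 * a') = 2 * N ^+ 3 * (N * a') by ring.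
  rewrite aE.
  have : (N - x) * ((2 * N + x) * (N ^+ 2 - x ^+ 3) * b) <= (N - x) * (2 * N ^+ 3 * a).
    by rewrite ler_wpM2l //; lra.
  have xx := mulr_ge0 x0 x0.
  have : 0 <= b * (N * (2 * N - x) * (2 * x ^+ 2 + 3 * x + 1)).
    by rewrite !mulr_ge0 //; nra.
  have : 0 <= b * (x ^+ 2 * (N * (N - x))) by rewrite !mulr_ge0 ?sqr_ge0 //; lra.
  have : 0 <= b * x ^+ 5 by rewrite mulr_ge0 ?exprn_ge0.
  lra.
have xN : j%:R <= N by rewrite ler_nat.
have x0 : 0 <= j%:R :> R by rewrite ler0n.
have b0 := bin_ratio_ge0 R (2 * n) j.
move: (B _ j) (A _ j) (j%:R) xN x0 b0 => b a x xN x0 b0 h.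
have N2 : 0 < 2 * N by lra.
rewrite -(ler_pM2l N2).
have : 0 <= b * (x * N ^+ 2) by rewrite !mulr_ge0 ?sqr_ge0.
have : 0 <= b * (x ^+ 3 * (2 * N - x)) by rewrite !mulr_ge0 ?exprn_ge0 //; lra.
lra.
Qed.

Lemma wallis_le_sqrt : wallis R (2 * n) <= 4 * Num.sqrt N.
Proof.
have w0 := wallis_gt0 R (2 * n).
have s0 : 0 <= 4 * Num.sqrt N by rewrite mulr_ge0 ?sqrtr_ge0.
rewrite -ler_sqr ?nnegrE ?(ltW w0) // [(4 * _) ^+ 2]exprMn sqr_sqrtr; last by have := N_ge1; lra.
have := wallis_le R (2 * n); rewrite -[(2 * (2 * n)).+1%:R]natr1 !natrM -/N => h.
have : pi * (2 * (2 * N) + 1) <= 4 * (2 * (2 * N) + 1).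
  by rewrite ler_wpM2r //; [have := N_ge1; lra | have := pihalf_lt2 R; lra].
have := N_ge1; lra.
Qed.

Lemma W_wallis : `|W R n / N - wallis R (2 * n) / 2| <= 23.
Proof.
have N0 : 0 < N by have := N_ge1; lra.
have n0 : N != 0 by rewrite gt_eqF.
rewrite W_ffact_ratio // -/N mulrAC divff // mul1r.
set SA := \sum_(j < _) _; set SB := \sum_(j < (2 * n).+1) B (2 * n) j.
have sB : 2 * SB = 1 + wallis R (2 * n) := sum_bin_ratio R (2 * n).
have s2n := natr_2n.
have up : 2 * N * SA <= 2 * N * SB + N.
  have lin := sum_bin_ratio_linear R (2 * n).
  have -> : 2 * N * SB + N = \sum_(j < (2 * n).+1) (2 * N + j%:R) * B (2 * n) j.
    under eq_bigr => j _ do rewrite mulrDl.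
    by rewrite big_split /= lin s2n -mulr_sumr; congr (_ + _); field.
  by rewrite mulr_sumr; apply: ler_sum => j _; exact: ffact_ratio_upper.
have low : N ^+ 2 * SB - 4 * N * (2 * N + SB) <= N ^+ 2 * SA.
  have cub := sum_bin_ratio_cubic R (2 * n).
  rewrite s2n -/SB in cub.
  apply: (@le_trans _ _ (\sum_(j < (2 * n).+1) (N ^+ 2 - 2 * j%:R ^+ 3) * B (2 * n) j)).
    under eq_bigr => j _ do rewrite mulrBl -mulrA.
    by rewrite big_split /= sumrN -!mulr_sumr -/SB; lra.
  by rewrite mulr_sumr; apply: ler_sum => j _; exact: ffact_ratio_lower.
have w0 := wallis_gt0 R (2 * n).
have wN : wallis R (2 * n) <= 4 * N.
  apply: le_trans wallis_le_sqrt _; rewrite ler_wpM2l //.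
  rewrite -ler_sqr ?nnegrE ?sqrtr_ge0 ?(ltW N0) // sqr_sqrtr ?(ltW N0) //.
  by rewrite expr2 ler_peMl ?(ltW N0) ?N_ge1.
have SA1 : SA <= SB + 1 / 2.
  have N2 : 0 < 2 * N by lra.
  by rewrite -(ler_pM2l N2); lra.
(* Here 20 = 8 + 12: the term 4N * 2N gives 8, and 4N * SB with SB <= 3N gives 12. *)
have SA2 : SB - 20 <= SA.
  have N2 : 0 < N ^+ 2 by rewrite exprn_gt0.
  rewrite -(ler_pM2l N2); apply: le_trans low.
  have : N * SB <= N * (3 * N) by rewrite ler_wpM2l ?ltW //; have := N_ge1; lra.
  lra.
by rewrite ler_norml; apply/andP; split; lra.
Qed.

Lemma W_sqr_asymp : `|W R n ^+ 2 / N ^+ 3 - pi / 2| <= 800 / Num.sqrt N.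
Proof.
have N0 : 0 < N by have := N_ge1; lra.
set s := Num.sqrt N; have s0 : 0 < s by rewrite sqrtr_gt0.
have sN : s ^+ 2 = N by rewrite sqr_sqrtr ?ltW.
have s1 : 1 <= s by rewrite -[1]sqrtr1 ler_wsqrtr // N_ge1.
have w0 := wallis_gt0 R (2 * n); have ws := wallis_le_sqrt; rewrite -/s in ws.
have h := W_wallis; have h1 := wallis_ge R (2 * n); have h2 := wallis_le R (2 * n).
rewrite -natr1 !natrM -/N in h1 h2.
have -> : W R n ^+ 2 / N ^+ 3 = (W R n / N) ^+ 2 / N.
  by field; rewrite gt_eqF.
move: h h1 h2 w0 ws; move: (W R n / N) (wallis R (2 * n)) => q c h h1 h2 c0 cs.
have p4 : pi <= 4 :> R by have := pihalf_lt2 R; lra.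
have n0 : N != 0 by rewrite gt_eqF.
have -> : q ^+ 2 / N - pi / 2 = (q ^+ 2 - pi / 2 * N) / N by field.
rewrite normrM [X in _ * X]gtr0_norm ?invr_gt0 // ler_pdivrMr //.
have -> : 800 / s * N = 800 * s by rewrite -sN; field; rewrite gt_eqF.
(* The first factor is bounded and the second is of order s, while the two Wallis inequalities keep
   the last difference within pi/8. The total is at most 530 + 92 s, well below 800 s as s >= 1. *)
have -> : q ^+ 2 - pi / 2 * N = (q - c / 2) * (q + c / 2) + (c ^+ 2 / 4 - pi / 2 * N) by field.
apply: le_trans (ler_normD _ _) _; rewrite normrM.
have k1 : `|q + c / 2| <= 23 + 4 * s.
  have -> : q + c / 2 = (q - c / 2) + c by field.
  apply: le_trans (ler_normD _ _) _.
  by rewrite (gtr0_norm c0) lerD.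
have k2 : `|q - c / 2| * `|q + c / 2| <= 23 * (23 + 4 * s) by rewrite ler_pM.
have k3 : `|c ^+ 2 / 4 - pi / 2 * N| <= 1.
  by rewrite ler_norml; apply/andP; split; lra.
lra.
Qed.

Lemma W_asymp0 : `|W R n / N ^+ 2 - 0| <= 30 / Num.sqrt N.
Proof.
have N0 : 0 < N by have := N_ge1; lra.
set s := Num.sqrt N; have s0 : 0 < s by rewrite sqrtr_gt0.
have sN : s ^+ 2 = N by rewrite sqr_sqrtr ?ltW.
have s1 : 1 <= s by rewrite -[1]sqrtr1 ler_wsqrtr // N_ge1.
have w0 := wallis_gt0 R (2 * n); have ws := wallis_le_sqrt; rewrite -/s in ws.
have h := W_wallis; rewrite subr0.
have n0 : N != 0 by rewrite gt_eqF.
have -> : W R n / N ^+ 2 = W R n / N / N by field.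
rewrite normrM [X in _ * X]gtr0_norm ?invr_gt0 // ler_pdivrMr //.
have -> : 30 / s * N = 30 * s by rewrite -sN; field; rewrite gt_eqF.
by move: h; rewrite !ler_norml => /andP[ha hb]; apply/andP; split; lra.
Qed.

End Fixed_n.

Local Open Scope classical_set_scope.

Lemma cvg_of_sqrt_bound (u : nat -> R) (l K : R) : 0 <= K ->
  (forall n, (0 < n)%N -> `|u n - l| <= K / Num.sqrt n%:R) ->
  u n @[n --> \oo] --> l.
Proof.
move=> K0 h; apply/cvgrPdist_le => e e0; near=> n.
have n0 : (0 < n)%N by near: n; exact: nbhs_infty_gt.
have N0 : 0 < n%:R :> R by rewrite ltr0n.
have s0 : 0 < Num.sqrt (n%:R : R) by rewrite sqrtr_gt0.
rewrite distrC; apply: le_trans (h n n0) _; rewrite ler_pdivrMr //.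
rewrite -ler_sqr ?nnegrE ?mulr_ge0 ?(ltW e0) ?(ltW s0) // [(e * _) ^+ 2]exprMn.
rewrite sqr_sqrtr ?(ltW N0) //.
have : (K / e) ^+ 2 <= n%:R by near: n; exact: nbhs_infty_ger.
by rewrite expr_div_n ler_pdivrMr ?exprn_gt0 // mulrC.
Unshelve. all: by end_near. Qed.

Lemma W_sqr_cvg : W R n ^+ 2 / n%:R ^+ 3 @[n --> \oo] --> pi / 2.
Proof.
by apply: (@cvg_of_sqrt_bound _ _ 800); [exact: ler0n | exact: W_sqr_asymp].
Qed.

Lemma W_cvg0 : W R n / n%:R ^+ 2 @[n --> \oo] --> 0.
Proof.
by apply: (@cvg_of_sqrt_bound _ _ 30); [exact: ler0n | exact: W_asymp0].
Qed.

End WAsymptotics.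

(** * Ten digits of pi *)

Section PiBounds.
Variable R : realType.
Implicit Types x : R.

Definition atan_taylor (k : nat) x : R :=
  \sum_(i < k) (-1) ^+ i * x ^+ (2 * i).+1 / (2 * i).+1%:R.

Lemma is_derive_atan_taylor k x :
  is_derive x 1 (atan_taylor k) (\sum_(i < k) (- x ^+ 2) ^+ i).
Proof.
have -> : atan_taylor k = \sum_(i < k) (((-1) ^+ i / (2 * i).+1%:R) \*: (@id R ^+ (2 * i).+1)).
  apply/funext => y; rewrite fct_sumE; apply: eq_bigr => i _.
  by rewrite exprfctE /= [RHS]/GRing.scale /= mulrAC.
apply: is_derive_sum => i.
apply: is_derive_eq.
rewrite /GRing.scale /= mulr1 [(- x ^+ 2) ^+ i]exprNn -exprM.
by have := natrS_neq0 R (2 * i); move: (2 * i).+1%:R (x ^+ _) => y z y0; field.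
Qed.

(** By the geometric sum, the derivative of atan minus its n-term Taylor sum is (-y^2)^n/(1 + y^2),
    whose sign is that of (-1)^n. *)
Lemma atan_bounds k x : 0 <= x ->
  atan_taylor (2 * k) x <= atan x <= atan_taylor (2 * k).+1 x.
Proof.
move=> x0.
have x2 (y : R) : 0 < 1 + y ^+ 2 by apply: ltr_pwDl => //; exact: sqr_ge0.
have geo n (y : R) : (1 + y ^+ 2) * (\sum_(i < n) (- y ^+ 2) ^+ i) = 1 - (- y ^+ 2) ^+ n.
  have := subrX1 (- y ^+ 2) n; move: (\sum_(i < n) _) => s e.
  have -> : 1 - (- y ^+ 2) ^+ n = - ((- y ^+ 2 - 1) * s) by rewrite -e opprB.
  by ring.
have t0 n : atan_taylor n 0 = 0.
  by rewrite /atan_taylor big1 // => i _; rewrite expr0n mulr0 mul0r.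
apply/andP; split.
  rewrite -subr_ge0; have <- : atan 0 - atan_taylor (2 * k) 0 = 0 :> R.
    by rewrite atan0 t0 subrr.
  apply: (@nondecr_of_derive R (fun y => atan y - atan_taylor (2 * k) y)
    (fun y => (1 + y ^+ 2)^-1 - \sum_(i < 2 * k) (- y ^+ 2) ^+ i)) => //.
    by move=> y; apply: is_deriveB; exact: is_derive_atan_taylor.
  move=> y _; rewrite subr_ge0 -(ler_pM2l (x2 y)) geo divff ?gt_eqF //.
  by rewrite gerBl exprM sqrrN exprn_ge0 // sqr_ge0.
rewrite -subr_ge0; have <- : atan_taylor (2 * k).+1 0 - atan 0 = 0 :> R.
  by rewrite atan0 t0 subrr.
apply: (@nondecr_of_derive R (fun y => atan_taylor (2 * k).+1 y - atan y)
  (fun y => \sum_(i < (2 * k).+1) (- y ^+ 2) ^+ i - (1 + y ^+ 2)^-1)) => //.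
  by move=> y; apply: is_deriveB; exact: is_derive_atan_taylor.
move=> y _; rewrite subr_ge0 -(ler_pM2l (x2 y)) geo divff ?gt_eqF //.
rewrite lerDl exprS mulNr opprK mulr_ge0 ?sqr_ge0 // exprM sqrrN.
by rewrite exprn_ge0 // sqr_ge0.
Qed.

(** The strict bound on b keeps the sum of the angles below pi/2, where [atan] inverts [tan]. *)
Lemma atanD (a b : R) : 0 <= a <= 1 -> 0 <= b < 1 ->
  atan a + atan b = atan ((a + b) / (1 - a * b)).
Proof.
move=> /andP[a0 a1] /andP[b0 b1].
have cos0 c : cos (atan c) != 0 :> R.
  by rewrite gt_eqF //; apply: cos_gt0_pihalf; rewrite atan_gtNpi2 atan_ltpi2.
rewrite -[LHS]tanK.
  by rewrite tanD // !atanK.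
have := le_atan a0; have := le_atan b0; rewrite atan0 => pb pa.
have := le_atan a1; have := lt_atan b1; rewrite atan1 => qb qa.
have pi0 := pi_gt0 R.
by rewrite in_itv /=; apply/andP; split; lra.
Qed.

(** Doubling the angle of slope 1/5 twice gives slope 120/119, which is also the slope of pi/4 +
    atan (1/239). *)
Lemma machin : pi = 16 * atan (1 / 5) - 4 * atan (1 / 239) :> R.
Proof.
have e1 : atan (1 / 5) + atan (1 / 5) = atan (5 / 12) :> R.
  by rewrite atanD; [congr atan; field | lra | lra].
have e2 : atan (5 / 12) + atan (5 / 12) = atan (120 / 119) :> R.
  by rewrite atanD; [congr atan; field | lra | lra].
have e3 : atan 1 + atan (1 / 239) = atan (120 / 119) :> R.
  by rewrite atanD; [congr atan; field | lra | lra].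
by rewrite atan1 in e3; lra.
Qed.

Lemma pi_bounds :
  3 + 14 / 10 ^+ 2 + 15 / 10 ^+ 4 + 92 / 10 ^+ 6 + 65 / 10 ^+ 8 + 35 / 10 ^+ 10 <= (pi : R)
  <= 3 + 14 / 10 ^+ 2 + 15 / 10 ^+ 4 + 92 / 10 ^+ 6 + 65 / 10 ^+ 8 + 36 / 10 ^+ 10.
Proof.
have i5 : 0 <= 1 / 5 :> R by lra.
have i239 : 0 <= 1 / 239 :> R by lra.
(* Eight and nine terms at 1/5, two and three at 1/239: each pair contributes an error of about
   10^-12 to pi. *)
have /andP[l5 u5] := atan_bounds 4 i5.
have /andP[l239 u239] := atan_bounds 1 i239.
move: l5 u5 l239 u239; rewrite machin /atan_taylor !big_ord_recr !big_ord0 /=.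
move: (atan _) (atan _) => a b.
rewrite !mulnS !muln0 !add2n.
move=> h1 h2 h3 h4.
apply/andP; split; lra.
Qed.

End PiBounds.

(** * Limits of the moments *)

Local Open Scope classical_set_scope.
Local Open Scope ring_scope.

Section Asymptotics.
Variable R : realType.

Lemma eq_cvg_gt0 (u v : nat -> R) (l : R) : (forall n, (0 < n)%N -> v n = u n) ->
  u @ \oo --> l -> v @ \oo --> l.
Proof.
move=> uv cu; apply: cvg_trans cu; apply: near_eq_cvg; near=> n.
by rewrite uv //; near: n; exact: nbhs_infty_gt.
Unshelve. all: by end_near. Qed.

Lemma cvg_natV : (n%:R^-1 : R) @[n --> \oo] --> 0.
Proof.
apply: (@cvg_of_sqrt_bound R _ _ 1); first exact: ler01.
move=> n n0; have N1 : 1 <= n%:R :> R by rewrite ler1n.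
have N0 : 0 < n%:R :> R by rewrite ltr0n.
have s0 : 0 < Num.sqrt (n%:R : R) by rewrite sqrtr_gt0.
rewrite subr0 gtr0_norm ?invr_gt0 // mul1r lef_pV2 ?posrE //.
rewrite -ler_sqr ?nnegrE ?(ltW N0) ?(ltW s0) // sqr_sqrtr ?(ltW N0) //.
by rewrite expr2 ler_peMl ?(ltW N0).
Qed.

Definition mu4_limit : R := - (3 / 4) * pi ^+ 2 + 5 / 4 * pi + 221 / 63.

(** Meant for p = W^2/n^3, q = W/n^2 and z = 1/n, in which the fourth moment divided by n^6 is a
    polynomial. Since W has order n^(3/2), only W^4, n^3 W^2 and n^6 reach the order n^6. *)
Lemma cvg_mu4_expansion (k1 k2 k3 k4 k5 k6 k7 k8 k9 k10 k11 k12 k13 k14 l : R) (p q z : nat -> R) :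
  p @ \oo --> l -> q @ \oo --> (0 : R) -> z @ \oo --> (0 : R) ->
  (fun n => k1 * (p n * p n) + k2 * (p n * q n) + (k3 + k4 * z n + k5 * (z n * z n)) * p n
    + (k6 + k7 * z n + k8 * (z n * z n) + k9 * (z n * (z n * z n))) * q n
    + (k10 + k11 * z n + k12 * (z n * z n) + k13 * (z n * (z n * z n))
       + k14 * ((z n * z n) * (z n * z n)))) @ \oo
  --> k1 * (l * l) + k3 * l + k10.
Proof.
move=> cp cq cz.
rewrite (_ : _ + k10 = k1 * (l * l) + k2 * (l * 0) + (k3 + k4 * 0 + k5 * (0 * 0)) * l
    + (k6 + k7 * 0 + k8 * (0 * 0) + k9 * (0 * (0 * 0))) * 0
    + (k10 + k11 * 0 + k12 * (0 * 0) + k13 * (0 * (0 * 0)) + k14 * ((0 * 0) * (0 * 0))));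
  last by ring.
have kM (k : R) (u : nat -> R) (a : R) : u @ \oo --> a -> k * u n @[n --> \oo] --> k * a.
  by move=> cu; apply: cvgM cu; exact: cvg_cst.
have add (u v : nat -> R) (a b : R) : u @ \oo --> a -> v @ \oo --> b ->
    u n + v n @[n --> \oo] --> a + b by exact: cvgD.
have mul (u v : nat -> R) (a b : R) : u @ \oo --> a -> v @ \oo --> b ->
    u n * v n @[n --> \oo] --> a * b by exact: cvgM.
have kC (k : R) : k @[_ --> \oo] --> k by exact: cvg_cst.
have z2 := mul _ _ _ _ cz cz; have z3 := mul _ _ _ _ cz z2; have z4 := mul _ _ _ _ z2 z2.
have cA := add _ _ _ _ (add _ _ _ _ (kC k3) (kM k4 _ _ cz)) (kM k5 _ _ z2).
have cB := add _ _ _ _ (add _ _ _ _ (add _ _ _ _ (kC k6) (kM k7 _ _ cz)) (kM k8 _ _ z2))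
  (kM k9 _ _ z3).
have cC := add _ _ _ _ (add _ _ _ _ (add _ _ _ _ (add _ _ _ _ (kC k10) (kM k11 _ _ cz))
  (kM k12 _ _ z2)) (kM k13 _ _ z3)) (kM k14 _ _ z4).
exact: (add _ _ _ _ (add _ _ _ _ (add _ _ _ _ (add _ _ _ _ (kM k1 _ _ (mul _ _ _ _ cp cp))
  (kM k2 _ _ (mul _ _ _ _ cp cq))) (mul _ _ _ _ cA cp)) (mul _ _ _ _ cB cq)) cC).
Qed.

Lemma height_mu4_cvg : height_mu4 R n / n%:R ^+ 6 @[n --> \oo] --> mu4_limit.
Proof.
have cF := @cvg_mu4_expansion (- 3) (- 17) (5 / 2) (- 217 / 6) (1 / 15) (649 / 80)
  (- 74381%:R / 2160) (433 / 2520) (1 / 105) (221 / 63) (4693 / 540) (- 4651 / 378)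
  (109 / 1260) (2 / 105) _ _ _ _ (@W_sqr_cvg R) (@W_cvg0 R) cvg_natV.
rewrite (_ : mu4_limit = -3 * (pi / 2 * (pi / 2)) + 5 / 2 * (pi / 2) + 221 / 63); last first.
  by rewrite /mu4_limit; field.
apply: eq_cvg_gt0 cF => n n0.
rewrite height_mu4E //.
have N0 : n%:R != 0 :> R by rewrite pnatr_eq0 -lt0n.
move: (74381%:R) (n%:R) N0 (W R n) => k N N0 w.
by field.
Qed.

Lemma height_var_cvg : height_var R n / n%:R ^+ 3 @[n --> \oo] --> (10 - 3 * pi) / 6.
Proof.
have cF : (5 / 3 + (- 5 / 3) * n%:R^-1 + ((- 17 / 6) * (W R n / n%:R ^+ 2)
    + (- 1) * (W R n ^+ 2 / n%:R ^+ 3)) @[n --> \oo] -->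
    5 / 3 + (- 5 / 3) * 0 + ((- 17 / 6) * 0 + (- 1) * (pi / 2 : R))).
  exact: (cvgD (cvgD (cvg_cst (5 / 3 : R)) (cvgM (cvg_cst (- 5 / 3 : R)) cvg_natV))
  (cvgD (cvgM (cvg_cst (- 17 / 6 : R)) (@W_cvg0 R)) (cvgM (cvg_cst (- 1 : R)) (@W_sqr_cvg R)))).
rewrite (_ : (10 - 3 * pi) / 6 = 5 / 3 + (- 5 / 3) * 0 + ((- 17 / 6) * 0 + (- 1) * (pi / 2)));
  last by field.
apply: eq_cvg_gt0 cF => n n0.
rewrite height_varE //.
have N0 : n%:R != 0 :> R by rewrite pnatr_eq0 -lt0n.
move: (n%:R) N0 (W R n) => N N0 w.
by field.
Qed.

Definition kurtosis_limit : R :=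
  1 / 7 * ((- 189 * pi ^+ 2 + 315 * pi + 884) / (10 - 3 * pi) ^+ 2).

Lemma ten_sub_3pi_neq0 : 10 - 3 * pi != 0 :> R.
Proof.
have /andP[_ h] := pi_bounds R; rewrite gt_eqF // subr_gt0.
move: h; rewrite !exprS !expr0; lra.
Qed.

Lemma kurtosis_limitE : kurtosis_limit = mu4_limit / ((10 - 3 * pi) / 6) ^+ 2.
Proof.
have := ten_sub_3pi_neq0; rewrite /kurtosis_limit /mu4_limit; move: (pi : R) => p h.
by field.
Qed.

Lemma kurtosis_limit_bounds :
  3 + 56 / 10 ^+ 2 + 3 / 10 ^+ 4 + 94 / 10 ^+ 6 <= kurtosis_limit
    < 3 + 56 / 10 ^+ 2 + 3 / 10 ^+ 4 + 95 / 10 ^+ 6.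
Proof.
have /andP[h1 h2] := pi_bounds R; have h0 := ten_sub_3pi_neq0.
have -> : kurtosis_limit = (- 27 * pi ^+ 2 + 45 * pi + 884 / 7) / (10 - 3 * pi) ^+ 2.
  by rewrite /kurtosis_limit; move: (pi : R) h0 => p h0; field.
have d0 : 0 < (10 - 3 * (pi : R)) ^+ 2 by rewrite exprn_even_gt0.
rewrite ler_pdivlMr // ltr_pdivrMr //.
move: (pi : R) h1 h2 {h0 d0} => p h1 h2.
(* The two inequalities are quadratic in p; the products below certify them. *)
move: (h1) (h2); rewrite -subr_ge0 => h1'; rewrite -subr_ge0 => h2'.
have e1 := mulr_ge0 h1' h2'; have e2 := mulr_ge0 h1' h1'.
apply/andP; split; lra.
Qed.

End Asymptotics.

Theorem theorem4 (R : realType) :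
  [/\ forall n : nat, (0 < n)%N ->
        let N : R := n%:R in
        let w : R := W R n in
        height_mu4 R n =
          - 3 * w ^+ 4 - 17 * N * w ^+ 3
          + (5 / 2 * N ^+ 3 - 217 / 6 * N ^+ 2 + 1 / 15 * N) * w ^+ 2
          + (649 / 80 * N ^+ 4 - 74381%:R / 2160 * N ^+ 3 + 433 / 2520 * N ^+ 2
             + 1 / 105 * N) * w
          + 221 / 63 * N ^+ 6 + 4693 / 540 * N ^+ 5 - 4651 / 378 * N ^+ 4
          + 109 / 1260 * N ^+ 3 + 2 / 105 * N ^+ 2,
      seq_equiv (height_mu4 R)
        (fun n : nat =>
           (- (3 / 4) * pi ^+ 2 + 5 / 4 * pi + 221 / 63) * n%:R ^+ 6)
    & let kurt : R :=
        1 / 7 * ((- 189 * pi ^+ 2 + 315 * pi + 884) / (10 - 3 * pi) ^+ 2) in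
      ((fun n : nat => height_mu4 R n / height_var R n ^+ 2) @ \oo --> kurt)
      /\ 3560394%:R / 10 ^+ 6 <= kurt < 3560395%:R / 10 ^+ 6 ].
Proof.
have /andP[kurt_ge _] := kurtosis_limit_bounds R.
have d0 := ten_sub_3pi_neq0 R.
(* Otherwise the limit of the kurtosis would be 0, against its numerical lower bound. *)
have mu0 : mu4_limit R != 0.
  apply/eqP => mu0; move: kurt_ge; rewrite kurtosis_limitE mu0 mul0r leNgt.
  lra.
split.
- exact: height_mu4E.
- rewrite /seq_equiv -[X in _ --> X](divff mu0).
  have cF : height_mu4 R n / n%:R ^+ 6 * (mu4_limit R)^-1 @[n --> \oo]
      --> mu4_limit R * (mu4_limit R)^-1.
    by apply: cvgM; [exact: height_mu4_cvg | exact: cvg_cst].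
  apply: eq_cvg_gt0 cF => n n0.
  have N0 : n%:R != 0 :> R by rewrite pnatr_eq0 -lt0n.
  by rewrite -/(mu4_limit R) invfM [_ / _ / _]mulrAC mulrA.
- have bounds (a b : R) : a = 3 * 10 ^+ 6 + 56 * 10 ^+ 4 + 3 * 10 ^+ 2 + 94 ->
      b = 3 * 10 ^+ 6 + 56 * 10 ^+ 4 + 3 * 10 ^+ 2 + 95 ->
      a / 10 ^+ 6 <= kurtosis_limit R < b / 10 ^+ 6.
    move=> -> ->; have /andP[h1 h2] := kurtosis_limit_bounds R.
    by apply/andP; split; [move: h1 {h2} | move: h2 {h1}]; move: (kurtosis_limit R) => k h; lra.
  split; last first.
    by apply: bounds; (apply: etrans (natr_of_num_uint R _) _; rewrite /decimal_value; ring).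
  rewrite -/(kurtosis_limit R) kurtosis_limitE.
  have v0 : ((10 - 3 * (pi : R)) / 6) ^+ 2 != 0.
    by rewrite expf_neq0 // mulf_neq0 // invr_eq0 pnatr_eq0.
  have cv : height_var R n / n%:R ^+ 3 * (height_var R n / n%:R ^+ 3) @[n --> \oo]
      --> ((10 - 3 * (pi : R)) / 6) ^+ 2.
    by rewrite expr2; apply: cvgM; exact: height_var_cvg.
  have cF : height_mu4 R n / n%:R ^+ 6
        * (height_var R n / n%:R ^+ 3 * (height_var R n / n%:R ^+ 3))^-1 @[n --> \oo]
      --> mu4_limit R * (((10 - 3 * (pi : R)) / 6) ^+ 2)^-1.
    by apply: cvgM; [exact: height_mu4_cvg | exact: cvgV].
  apply: eq_cvg_gt0 cF => n n0.
  have N0 : n%:R != 0 :> R by rewrite pnatr_eq0 -lt0n.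
  rewrite -[in RHS]expr2 [in RHS]expr_div_n invf_div -[6%N]/(3 * 2)%N exprM mulrA.
  by rewrite divfK // !expf_neq0.
Qed.
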